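(* Let $X\subset\mathbb R^n$ be compact. Fix $\delta\in(0,1)$, $B_h>0$, $h\in\mathcal F_2(B_h)$ with representing density $\alpha$ (that is, $h(\cdot)=\int_\Theta\Phi(\cdot,\theta)\alpha(\theta)d\nu(\theta)$ with $\operatorname{ess\,sup}_{\theta\in\Theta}\|\alpha(\theta)\|_2\le B_h$), and a positive integer $K$. Let $\theta_1,\dots,\theta_K$ be i.i.d. draws from $\nu$, and put $\eta=\frac{\delta}{2K}$. With probability at least $1-\delta$, there exist weights $\{\alpha_i\}_{i=1}^K\subset\mathbb R^{d_1}$ such that $\|\alpha_i\|_2\le B_h$ for $i=1,\dots,K$, and $$\Big\|\frac1K\sum_{i=1}^K\Phi(\cdot,\theta_i)\alpha_i-h\Big\|_\infty\le\frac2K\,\mathbb E\Big\|\sum_{i=1}^K\varepsilon_i\Phi_\eta(\cdot,\theta_i)\alpha(\theta_i)\Big\|_\infty+\sqrt2\,B_\Phi(\eta)B_h\sqrt{\frac{\log(2/\delta)}{K}}+B_h\sqrt{\frac{\delta\,\sup_{x\in X}\mathbb E\|\Phi(x,\theta)\|_{\mathrm{op}}^2}{2K}},$$ where each $\varepsilon_i$ is an i.i.d. Rademacher random variable ($\mathbb P(\varepsilon_i=1)=\mathbb P(\varepsilon_i=-1)=1/2$).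
   Context: $\Theta$ is a measurable space with a probability measure $\nu$, and $\Phi:\mathbb R^n\times\Theta\to\mathbb R^{d\times d_1}$ ($d_1\le d$) is a feature map. $\|\cdot\|_{\mathrm{op}}$ is the $\ell_2\to\ell_2$ operator norm and $\|f\|_\infty:=\sup_{x\in X}\|f(x)\|_2$. For $B>0$, $$\mathcal F_2(B)=\Big\{f(\cdot)=\int_\Theta\Phi(\cdot,\theta)\alpha(\theta)d\nu(\theta)\ \Big|\ \operatorname*{ess\,sup}_{\theta\in\Theta}\|\alpha(\theta)\|_2\le B\Big\},$$ with $\alpha:\Theta\to\mathbb R^{d_1}$. $B_\Phi$ is any function on $(0,1)$ satisfying, for every $\delta\in(0,1)$, $\mathbb P_{\theta\sim\nu}\big(\sup_{x\in X}\|\Phi(x,\theta)\|_{\mathrm{op}}>B_\Phi(\delta)\big)\le\delta$. For $\eta\in(0,1)$, the truncated feature map is $\Phi_\eta(x,\theta):=\Phi(x,\theta)\mathbf 1\{\|\Phi(x,\theta)\|_{\mathrm{op}}\le B_\Phi(\eta)\}$. In the bound, $\mathbb E\|\Phi(x,\theta)\|_{\mathrm{op}}^2$ is over $\theta\sim\nu$, and the Rademacher expectation is over the $\theta_i$ and the $\varepsilon_i$ (independent of the $\theta_i$). *)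

(* Defs.v *)
From mathcomp Require Import all_boot all_order all_algebra.
From mathcomp Require Import all_classical all_reals all_analysis.
From mathcomp Require Import measurable_realfun ess_sup_inf.

Set Implicit Arguments.
Unset Strict Implicit.
Unset Printing Implicit Defensive.

Import Order.TTheory GRing.Theory Num.Theory.
Import numFieldNormedType.Exports.

Local Open Scope classical_set_scope.
Local Open Scope ring_scope.

Section Norms.
Context {R : realType}.

(* The norm that MathComp-Analysis puts on matrices is the max-entry norm,
   hence these two definitions. *)
Definition norm2 (m : nat) (v : 'cV[R]_m) : R :=
  Num.sqrt (\sum_(i < m) v i 0 ^+ 2).

Definition opnorm (m p : nat) (A : 'M[R]_(m, p)) : R :=
  sup [set norm2 (A *m v) | v in [set v : 'cV[R]_p | norm2 v <= 1]].

(* Extended-real valued, since f may be unbounded on X. *)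
Definition supnorm (T : Type) (X : set T) (m : nat) (f : T -> 'cV[R]_m) :
    \bar R :=
  ereal_sup [set (norm2 (f x))%:E | x in X].

End Norms.

Section Probability.
Context {R : realType} {d : measure_display} {T : measurableType d}.

(* Outer and inner probability bounds: for a measurable event A they say
   P A <= p and P A >= p. They are used because a supremum over an uncountable
   index set need not be measurable, and the library's P A is meaningful
   only for measurable A. *)
Definition prob_le (P : probability T R) (A : set T) (p : R) : Prop :=
  exists M : set T, [/\ measurable M, A `<=` M & (P M <= p%:E)%E].

Definition prob_ge (P : probability T R) (A : set T) (p : R) : Prop :=
  exists M : set T, [/\ measurable M, M `<=` A & (p%:E <= P M)%E].

Definition has_law (P : probability T R) (d' : measure_display)
    (T' : measurableType d') (Y : T -> T') (mu : probability T' R) : Prop :=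
  measurable_fun setT Y /\
  forall A : set T', measurable A -> P (Y @^-1` A) = mu A.

Definition rademacher (P : probability T R) (e : T -> R) : Prop :=
  [/\ measurable_fun setT e,
      P (e @^-1` [set 1]) = (2^-1)%:E & P (e @^-1` [set -1]) = (2^-1)%:E].

(* Mutual independence of the whole collection (Y_i)_i, (Z_j)_j; the product
   rule for subfamilies is the case where some A_i or B_j is the full space. *)
Definition mutually_independent (P : probability T R)
    (d1 d2 : measure_display)
    (T1 : measurableType d1) (T2 : measurableType d2)
    (I J : finType) (Y : I -> T -> T1) (Z : J -> T -> T2) : Prop :=
  forall (A : I -> set T1) (B : J -> set T2),
    (forall i, measurable (A i)) -> (forall j, measurable (B j)) ->
    P ((\bigcap_i (Y i @^-1` A i)) `&` (\bigcap_j (Z j @^-1` B j)))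
    = ((\prod_i P (Y i @^-1` A i)) * (\prod_j P (Z j @^-1` B j)))%E.

End Probability.

Section FeatureMap.
Context {R : realType} {disp : measure_display} {Theta : measurableType disp}.
Variables (n d d1 : nat).
Variable nu : probability Theta R.
Variable Phi : 'cV[R]_n -> Theta -> 'M[R]_(d, d1).

Definition measurable_feature_map : Prop :=
  forall (x : 'cV[R]_n) (i : 'I_d) (j : 'I_d1),
    measurable_fun setT (fun t => Phi x t i j).

(* f(x) is the coordinatewise Lebesgue integral of Phi(x, t) alpha(t). *)
Definition represents (B : R) (alpha : Theta -> 'cV[R]_d1)
    (f : 'cV[R]_n -> 'cV[R]_d) : Prop :=
  [/\ forall j : 'I_d1, measurable_fun setT (fun t => alpha t j 0),
      (ess_sup nu (fun t => (norm2 (alpha t))%:E) <= B%:E)%E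
    & forall (x : 'cV[R]_n) (i : 'I_d),
        nu.-integrable setT (EFin \o (fun t => (Phi x t *m alpha t) i 0)) /\
        f x i 0 = \int[nu]_t (Phi x t *m alpha t) i 0].

Definition F2 (B : R) : set ('cV[R]_n -> 'cV[R]_d) :=
  [set f | exists alpha, represents B alpha f].

Definition feature_tail_bound (X : set 'cV[R]_n) (BPhi : R -> R) : Prop :=
  forall delta : R, 0 < delta < 1 ->
    prob_le nu
      [set t | ((BPhi delta)%:E <
                ereal_sup [set (opnorm (Phi x t))%:E | x in X])%E]
      delta.

Definition truncate (b : R) (x : 'cV[R]_n) (t : Theta) : 'M[R]_(d, d1) :=
  if opnorm (Phi x t) <= b then Phi x t else 0.

(* || sum_i e_i Phi_b(., t_i) alpha(t_i) ||_oo, with b the truncation level *)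
Definition signed_sum_norm (X : set 'cV[R]_n) (b : R)
    (alpha : Theta -> 'cV[R]_d1) (K : nat) (e : 'I_K -> R) (t : 'I_K -> Theta) :
    \bar R :=
  supnorm X (fun x => \sum_(i < K) e i *: (truncate b x (t i) *m alpha (t i))).

End FeatureMap.

(* Main.v *)
Require Import Defs.
From HB Require Import structures.
From mathcomp Require Import all_boot all_order all_algebra.
From mathcomp Require Import all_classical all_reals all_analysis.
From mathcomp Require Import measurable_realfun ess_sup_inf.
From mathcomp Require Import ring lra.

Set Implicit Arguments.
Unset Strict Implicit.
Unset Printing Implicit Defensive.

Import Order.TTheory GRing.Theory Num.Theory.
Import numFieldNormedType.Exports.

Local Open Scope classical_set_scope.
Local Open Scope ring_scope.

(** The claim is that [K] random features carrying the weights [alpha (theta_i)]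
    approximate [h] uniformly on [X]. Three quantities are compared with [h]:
    the empirical mean of the features, the same mean of the features truncated
    at the level [b = BPhi eta], and the expectation [m] of the truncated
    features.

    Outside an event of probability at most [K eta = delta / 2] every draw
    satisfies both the tail bound and the essential bound on [alpha], and then
    the first two agree. The distance from [m] to [h] is at most
    [Bh E(|Phi| 1(|Phi| > b)) <= Bh sqrt (eta E |Phi|^2)]
    ([truncation_bias_le]). What is left is the uniform deviation of an
    empirical mean of vectors of norm at most [c = b Bh] ([uniform_deviation]).

    That deviation is a supremum over an uncountable set and, unlike the signed
    sums, it need not be measurable, so a concentration inequality cannot be
    applied to it directly. Fix signs [s_i] and let [W(t)] be the supremum norm
    of [sum_i s_i g(t_i)]. For an independent ghost sample [t'], let [u] take
    its entries from [t] where the sign is positive and from [t'] elsewhere, and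
    let [v] be made of the other entries. Then
    [sum_i (g(t_i) - g(t'_i)) = sum_i s_i g(u_i) - sum_i s_i g(v_i)], so that the
    deviation at [t] is at most [G(t) = (1 / K) E_t' (W(u) + W(v))]. This bound
    holds for every [t]; the function [G] is measurable; its mean is
    [(2 / K) E W], because [u] and [v] are again samples; and changing one draw
    moves it by at most [2 c / K], because that draw occurs in only one of [u]
    and [v]. McDiarmid's inequality for [G] ([mcdiarmid]) thus yields both the
    symmetrized expectation and the deviation term with the sharp constant.

    Finally, the Rademacher expectation is the average of [E W] over the sign
    patterns, so some pattern has [E W] below it ([exists_signs_le]), and [G] is
    built from that pattern. *)

(** * Euclidean and operator norms *)

Section EuclideanNorm.
Context {R : realType}.

Lemma sum_sqr_ge0 m (v : 'cV[R]_m) : 0 <= \sum_(i < m) v i 0 ^+ 2.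
Proof. by apply: sumr_ge0 => i _; exact: sqr_ge0. Qed.

Lemma norm2_ge0 m (v : 'cV[R]_m) : 0 <= norm2 v.
Proof. exact: sqrtr_ge0. Qed.

Lemma sqr_norm2 m (v : 'cV[R]_m) : norm2 v ^+ 2 = \sum_(i < m) v i 0 ^+ 2.
Proof. by rewrite sqr_sqrtr ?sum_sqr_ge0. Qed.

Lemma norm2_0 m : norm2 (0 : 'cV[R]_m) = 0.
Proof.
by rewrite /norm2 big1 ?sqrtr0// => i _; rewrite mxE expr0n.
Qed.

Lemma norm2Z m (c : R) (v : 'cV[R]_m) : norm2 (c *: v) = `|c| * norm2 v.
Proof.
rewrite /norm2 -sqrtr_sqr -sqrtrM ?sqr_ge0// mulr_sumr.
by under eq_bigr do rewrite mxE exprMn.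
Qed.

Lemma norm2N m (v : 'cV[R]_m) : norm2 (- v) = norm2 v.
Proof. by rewrite -scaleN1r norm2Z normrN1 mul1r. Qed.

Lemma norm2_eq0 m (v : 'cV[R]_m) : norm2 v = 0 -> v = 0.
Proof.
move=> v0; have : norm2 v ^+ 2 = 0 by rewrite v0 expr0n.
rewrite sqr_norm2 => /eqP; rewrite psumr_eq0 => [/allP h|i _]; last exact: sqr_ge0.
apply/colP => i; rewrite mxE; apply/eqP; rewrite -sqrf_eq0.
exact: h (mem_index_enum i).
Qed.

(** Cauchy-Schwarz, by summing over the entries the inequality between
    arithmetic and geometric means
    [2 (|u| |v|) u_i v_i <= |v|^2 u_i^2 + |u|^2 v_i^2]. *)
Lemma dot_le_norm2 m (u v : 'cV[R]_m) :
  \sum_(i < m) u i 0 * v i 0 <= norm2 u * norm2 v.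
Proof.
have [u0|u0] := eqVneq (norm2 u) 0.
  rewrite u0 mul0r (norm2_eq0 u0) big1// => i _.
  by rewrite mxE mul0r.
have [v0|v0] := eqVneq (norm2 v) 0.
  rewrite v0 mulr0 (norm2_eq0 v0) big1// => i _.
  by rewrite mxE mulr0.
have a0 : 0 < norm2 u by rewrite lt_def u0 norm2_ge0.
have b0 : 0 < norm2 v by rewrite lt_def v0 norm2_ge0.
have ab0 : 0 < 2 * (norm2 u * norm2 v) by rewrite mulr_gt0// mulr_gt0.
rewrite -(ler_pM2l ab0) mulr_sumr.
apply: (@le_trans _ _ (\sum_i (norm2 v ^+ 2 * u i 0 ^+ 2 + norm2 u ^+ 2 * v i 0 ^+ 2))).
  apply: ler_sum => i _; have := sqr_ge0 (norm2 v * u i 0 - norm2 u * v i 0).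
  lra.
rewrite big_split /= -!mulr_sumr -!sqr_norm2; lra.
Qed.

Lemma ler_norm2D m (u v : 'cV[R]_m) : norm2 (u + v) <= norm2 u + norm2 v.
Proof.
have uv0 : 0 <= norm2 u + norm2 v by rewrite addr_ge0 ?norm2_ge0.
rewrite -(ler_pXn2r (n := 2)) ?nnegrE ?norm2_ge0//.
have -> : norm2 (u + v) ^+ 2 =
    norm2 u ^+ 2 + 2 * \sum_i (u i 0 * v i 0) + norm2 v ^+ 2.
  rewrite !sqr_norm2 mulr_sumr -!big_split /=.
  by apply: eq_bigr => i _; rewrite mxE; ring.
have := dot_le_norm2 u v; lra.
Qed.

Lemma ler_norm2B m (u v : 'cV[R]_m) : norm2 (u - v) <= norm2 u + norm2 v.
Proof. by rewrite (le_trans (ler_norm2D _ _))// norm2N. Qed.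

Lemma ler_norm2_sum m (I : Type) (r : seq I) (P : pred I) (F : I -> 'cV[R]_m) :
  norm2 (\sum_(i <- r | P i) F i) <= \sum_(i <- r | P i) norm2 (F i).
Proof.
elim/big_ind2 : _ => [|x a y b xa yb|//]; first by rewrite norm2_0.
by rewrite (le_trans (ler_norm2D _ _))// lerD.
Qed.

Lemma ler_coord_norm2 m (v : 'cV[R]_m) i : `|v i 0| <= norm2 v.
Proof.
rewrite -sqrtr_sqr ler_wsqrtr// (bigD1 i)//= lerDl.
by apply: sumr_ge0 => j _; exact: sqr_ge0.
Qed.

Lemma norm2_le_sum m (v : 'cV[R]_m) : norm2 v <= \sum_i `|v i 0|.
Proof.
have {1}-> : v = \sum_i v i 0 *: delta_mx i 0.
  by rewrite {1}[v]matrix_sum_delta; apply: eq_bigr => i _; rewrite big_ord1.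
apply: (le_trans (ler_norm2_sum _ _ _)); apply: ler_sum => i _.
rewrite norm2Z.
have -> : norm2 (delta_mx i 0 : 'cV[R]_m) = 1.
  rewrite /norm2 (bigD1 i)//= big1 => [|j ji]; last first.
    by rewrite mxE (negbTE ji) expr0n.
  by rewrite mxE !eqxx expr1n addr0 sqrtr1.
by rewrite mulr1.
Qed.

Lemma norm2_signed_sum_le m K (s : 'I_K -> R) (v : 'I_K -> 'cV[R]_m) (c : R) :
  (forall i, `|s i| = 1) -> (forall i, norm2 (v i) <= c) ->
  norm2 (\sum_i s i *: v i) <= K%:R * c.
Proof.
move=> s1 vc; apply: (le_trans (ler_norm2_sum _ _ _)).
rewrite mulr_natl -[in leRHS](card_ord K) -sumr_const; apply: ler_sum => i _.
by rewrite norm2Z s1 mul1r.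
Qed.

Lemma le_supnorm (T : Type) (X : set T) m (f : T -> 'cV[R]_m) x :
  X x -> ((norm2 (f x))%:E <= supnorm X f)%E.
Proof. by move=> Xx; apply: ereal_sup_ubound; exists x. Qed.

Lemma supnorm_le (T : Type) (X : set T) m (f : T -> 'cV[R]_m) (y : R) :
  (forall x, X x -> norm2 (f x) <= y) -> (supnorm X f <= y%:E)%E.
Proof. by move=> fy; apply: ge_ereal_sup => _ [x Xx <-]; rewrite lee_fin fy. Qed.

Lemma supnorm_ge0 (T : Type) (X : set T) m (f : T -> 'cV[R]_m) :
  X !=set0 -> (0 <= supnorm X f)%E.
Proof.
by move=> [x Xx]; apply: le_trans (le_supnorm f Xx); rewrite lee_fin norm2_ge0.
Qed.

End EuclideanNorm.

Section OperatorNorm.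
Context {R : realType}.
Implicit Types m p : nat.

Let image_ball m p (A : 'M[R]_(m, p)) : set R :=
  [set norm2 (A *m v) | v in [set v : 'cV[R]_p | norm2 v <= 1]].

(** A crude bound; it makes the supremum defining the operator norm finite. *)
Lemma norm2_mulmx_le_entries m p (A : 'M[R]_(m, p)) (v : 'cV[R]_p) :
  norm2 (A *m v) <= (\sum_i \sum_j `|A i j|) * norm2 v.
Proof.
apply: (le_trans (norm2_le_sum _)); rewrite mulr_suml ler_sum// => i _.
rewrite mxE mulr_suml (le_trans (ler_norm_sum _ _ _))// ler_sum// => j _.
by rewrite normrM ler_wpM2l// ler_coord_norm2.
Qed.

Lemma has_sup_image_ball m p (A : 'M[R]_(m, p)) : has_sup (image_ball A).
Proof.
split; first by exists (norm2 (A *m 0)); exists 0 => //=; rewrite norm2_0.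
exists (\sum_i \sum_j `|A i j|) => _ [v /= v1 <-].
apply: (le_trans (norm2_mulmx_le_entries A v)); rewrite ler_piMr//.
by apply: sumr_ge0 => i _; apply: sumr_ge0.
Qed.

Lemma opnorm_ge0 m p (A : 'M[R]_(m, p)) : 0 <= opnorm A.
Proof.
apply: (le_trans (norm2_ge0 (A *m 0))).
apply: ub_le_sup; first exact: (has_sup_image_ball A).2.
by exists 0 => //=; rewrite norm2_0.
Qed.

Lemma norm2_mulmx_le m p (A : 'M[R]_(m, p)) (v : 'cV[R]_p) :
  norm2 (A *m v) <= opnorm A * norm2 v.
Proof.
have [v0|v0] := eqVneq (norm2 v) 0.
  by rewrite v0 mulr0 (norm2_eq0 v0) mulmx0 norm2_0.
have v_gt0 : 0 < norm2 v by rewrite lt_def v0 norm2_ge0.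
rewrite -ler_pdivrMr//.
apply: ub_le_sup; first exact: (has_sup_image_ball A).2.
exists ((norm2 v)^-1 *: v) => /=.
  by rewrite norm2Z ger0_norm ?invr_ge0 ?norm2_ge0// mulVf.
by rewrite -scalemxAr norm2Z ger0_norm ?invr_ge0 ?norm2_ge0// mulrC.
Qed.

Lemma opnorm_le m p (A : 'M[R]_(m, p)) (c : R) : 0 <= c ->
  (forall v, norm2 (A *m v) <= c * norm2 v) -> opnorm A <= c.
Proof.
move=> c0 Ac; apply: ge_sup; first exact: (has_sup_image_ball A).1.
by move=> _ [v /= v1 <-]; rewrite (le_trans (Ac v))// ler_piMr.
Qed.

(** Rational test vectors suffice to bound an operator norm, since they are
    dense; this is what makes the operator norm of a measurable matrix
    measurable. *)
Lemma opnorm_le_rat m p (A : 'M[R]_(m, p)) (c : R) : 0 <= c ->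
  (forall q : 'cV[rat]_p,
     norm2 (A *m map_mx ratr q) <= c * norm2 (map_mx ratr q : 'cV[R]_p)) ->
  opnorm A <= c.
Proof.
move=> c0 Aq; apply: opnorm_le => // v; apply/ler_addgt0Pr => e e0.
pose N := \sum_i \sum_j `|A i j|.
have N0 : 0 <= N by apply: sumr_ge0 => i _; apply: sumr_ge0.
(* replacing [v] by a rational vector within [e / D] entrywise costs at most
   [(N + c) * (p%:R * (e / D))], hence at most [e] *)
pose D := (N + c) * p%:R + 1.
have D0 : 0 < D by rewrite ltr_wpDl// mulr_ge0// addr_ge0.
have h0 : 0 < e / D by rewrite divr_gt0.
have near_rat (i : 'I_p) : {q : rat | `|ratr q - v i 0| < e / D}.
  apply: cid; have [|q] := @rat_in_itvoo R (v i 0 - e / D) (v i 0 + e / D).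
    by rewrite ltrD2l; lra.
  by rewrite in_itv/= => ?; exists q; rewrite ltr_distl.
pose q : 'cV[rat]_p := \col_i sval (near_rat i).
pose w : 'cV[R]_p := map_mx ratr q - v.
have w_small : norm2 w <= p%:R * (e / D).
  apply: (le_trans (norm2_le_sum _)).
  rewrite mulr_natl -[in leRHS](card_ord p) -sumr_const.
  by apply: ler_sum => i _; rewrite !mxE ltW//; case: (near_rat i).
have Aw := norm2_mulmx_le_entries A w.
have Hv : norm2 (A *m v) <= norm2 (A *m map_mx ratr q) + norm2 (A *m w).
  have -> : A *m v = A *m map_mx ratr q - A *m w.
    by rewrite -mulmxBr /w opprB addrCA subrr addr0.
  exact: ler_norm2B.
have Hq : norm2 (map_mx ratr q : 'cV[R]_p) <= norm2 v + norm2 w.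
  have -> : map_mx ratr q = v + w by rewrite /w addrCA subrr addr0.
  exact: ler_norm2D.
have De : (N + c) * (p%:R * (e / D)) <= e.
  have -> : (N + c) * (p%:R * (e / D)) = e * ((N + c) * p%:R / D) by ring.
  by rewrite ler_piMr ?(ltW e0)// ler_pdivrMr// mul1r lerDl.
have := Aq q; have := ler_wpM2l c0 Hq.
have : (N + c) * norm2 w <= (N + c) * (p%:R * (e / D)).
  by rewrite ler_wpM2l// addr_ge0.
move: Aw; rewrite -/N; lra.
Qed.

End OperatorNorm.

Section MeasurableNorms.
Context {R : realType} {disp : measure_display} {T : measurableType disp}.

Lemma measurable_norm2 m (f : T -> 'cV[R]_m) :
  (forall i, measurable_fun setT (fun t => f t i 0)) ->
  measurable_fun setT (fun t => norm2 (f t)).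
Proof.
move=> mf.
have ms : measurable_fun [set: R] (@Num.sqrt R).
  exact: continuous_measurable_fun (@sqrt_continuous R).
apply: (measurableT_comp ms); apply: measurable_sum => i.
by under eq_fun do rewrite expr2; exact: measurable_funM.
Qed.

Lemma measurable_mulmx m p (A : T -> 'M[R]_(m, p)) (v : T -> 'cV[R]_p) :
  (forall i j, measurable_fun setT (fun t => A t i j)) ->
  (forall j, measurable_fun setT (fun t => v t j 0)) ->
  forall i, measurable_fun setT (fun t => (A t *m v t) i 0).
Proof.
move=> mA mv i; under eq_fun do rewrite mxE.
by apply: measurable_sum => j; exact: measurable_funM.
Qed.

Lemma measurable_opnorm m p (A : T -> 'M[R]_(m, p)) :
  (forall i j, measurable_fun setT (fun t => A t i j)) ->
  measurable_fun setT (fun t => opnorm (A t)).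
Proof.
move=> mA; apply: (measurability _ (RGenOInfty.measurableE R)) => _ [_ [y ->] <-].
rewrite setTI; have [y0|y0] := ltP y 0.
  rewrite (_ : _ @^-1` _ = setT)//; apply/seteqP; split => // t _ /=.
  by rewrite in_itv/= andbT (lt_le_trans y0)// opnorm_ge0.
(* membership of a sublevel set is tested on the countably many rational vectors *)
pose F k := if @unpickle 'cV[rat]_p k is Some q then
    [set t | norm2 (A t *m map_mx ratr q) <= y * norm2 (map_mx ratr q : 'cV[R]_p)]
  else setT.
rewrite (_ : _ @^-1` _ = ~` \bigcap_k F k); last first.
  apply/seteqP; split => t /=; rewrite in_itv/= andbT => H.
    move=> FH; move: H; apply/negP; rewrite -leNgt; apply: opnorm_le_rat => // q.
    by have := FH (pickle q) I; rewrite /F pickleK.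
  rewrite ltNge; apply/negP => Hy; apply: H => k _; rewrite /F.
  case: (unpickle k) => //= q.
  by rewrite (le_trans (norm2_mulmx_le _ _))// ler_wpM2r// norm2_ge0.
apply: measurableC; apply: bigcap_measurableType => k _; rewrite /F.
case: (unpickle k) => // q; rewrite -[X in measurable X]setTI.
apply: measurable_fun_le => //; apply: measurable_norm2 => i.
by apply: measurable_mulmx => // j; under eq_fun do rewrite mxE; exact: measurable_cst.
Qed.

End MeasurableNorms.

(** * Hoeffding's lemma *)

Section HoeffdingLemma.
Context {R : realType}.

Lemma le_of_ge0_derive (f df : R -> R) :
  (forall x : R, 0 <= x -> is_derive x (1 : R) f (df x)) ->
  (forall x, 0 <= x -> 0 <= df x) ->
  forall x, 0 <= x -> f 0 <= f x.
Proof.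
move=> f_df df0 x x0.
have cf y : 0 <= y -> {for y, continuous f}.
  move=> y0; apply/differentiable_continuous/derivable1_diffP.
  by have [] := f_df _ y0.
apply: (@ger0_derive1_ndecr _ f 0 x) => // [y|y|].
- by rewrite in_itv/= => /andP[/ltW y0 _]; have [] := f_df _ y0.
- rewrite in_itv/= => /andP[/ltW y0 _]; rewrite derive1E.
  by have [_ ->] := f_df _ y0; exact: df0.
- apply: derivable_within_continuous => y; rewrite in_itv/= => /andP[y0 _].
  by have [] := f_df _ y0.
Qed.

(** The Bernoulli case of Hoeffding's lemma. With [u h] the left-hand side,
    [p h + h^2 / 8 - ln (u h)] vanishes at [0] together with its derivative,
    and its second derivative [1 / 4 - p (1 - p) e^h / (u h)^2] is
    nonnegative, being of the form [1 / 4 - q (1 - q)]. *)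
Lemma bernoulli_mgf_le (p h : R) : 0 <= p <= 1 -> 0 <= h ->
  1 - p + p * expR h <= expR (p * h + h ^+ 2 / 8).
Proof.
move=> /andP[p0 p1] h0.
pose u (x : R) : R := 1 - p + p * expR x.
have u_gt0 x : 0 < u x.
  have := expR_gt0 x; rewrite /u => ex.
  have [->|pne1] := eqVneq p 1; first by lra.
  have : p < 1 by rewrite lt_neqAle pne1.
  have : 0 <= p * expR x by rewrite mulr_ge0// ltW.
  lra.
have u0 x : u x != 0 by rewrite gt_eqF.
have du x : is_derive x (1 : R) u (p * expR x).
  rewrite /u; apply: is_derive_eq.
  by rewrite add0r mul1r.
pose psi (x : R) : R := p + x / 4 - p * expR x / u x.
have psi_ge0 x : 0 <= x -> 0 <= psi x.
  move=> x0; have -> : 0 = psi 0.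
    by rewrite /psi /u expR0 mulr1 subrK divr1 mul0r addr0 subrr.
  pose dpsi (y : R) : R := 4^-1 - p * expR y * (1 - p) / u y ^+ 2.
  apply: (@le_of_ge0_derive psi dpsi) => // y y0.
    rewrite /psi; apply: is_derive_eq.
    rewrite /dpsi /GRing.scale /=; have := u0 y; rewrite /u.
    by move: (expR y) => e ne; field.
  rewrite /dpsi subr_ge0 ler_pdivrMr ?exprn_gt0//.
  have := sqr_ge0 (1 - p - p * expR y).
  rewrite /u; lra.
pose phi (x : R) : R := p * x + x ^+ 2 / 8 - ln (u x).
have phi_ge0 : 0 <= phi h.
  have -> : 0 = phi 0.
    by rewrite /phi /u expR0 mulr1 subrK ln1; lra.
  apply: (@le_of_ge0_derive phi psi _ psi_ge0 h h0) => y y0.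
  have dlnu : is_derive y (1 : R) (fun x => ln (u x)) ((u y)^-1 * (p * expR y)).
    exact: is_derive1_comp (is_derive1_ln (u_gt0 y)) (du y).
  have dpoly : is_derive y (1 : R) (fun x : R => p * x + x ^+ 2 / 8) (p + y / 4).
    by apply: is_derive_eq; rewrite /GRing.scale /=; field.
  have -> : psi y = (p + y / 4) - (u y)^-1 * (p * expR y).
    by rewrite /psi (mulrC (u y)^-1).
  exact: is_deriveB dpoly dlnu.
have : ln (u h) <= p * h + h ^+ 2 / 8 by move: phi_ge0; rewrite /phi; lra.
by rewrite -ler_expR lnK// posrE.
Qed.

Lemma expR_le_chord (q h : R) : 0 <= q <= 1 -> expR (q * h) <= 1 - q + q * expR h.
Proof.
(* both endpoints of the chord lie above the tangent at [q h] *)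
move=> /andP[q0 q1]; set z := q * h.
have e0 : expR z * (1 - z) <= 1.
  have := ler_wpM2l (expR_ge0 z) (expR_ge1Dx (- z)).
  by rewrite -expRD subrr expR0.
have e1 : expR z * (1 + (h - z)) <= expR h.
  have := ler_wpM2l (expR_ge0 z) (expR_ge1Dx (h - z)).
  by rewrite -expRD [z + _]addrC subrK.
have := ler_wpM2l q0 e1.
have := ler_wpM2l (_ : 0 <= 1 - q) e0; rewrite subr_ge0 => /(_ q1).
have : (1 - q) * (expR z * (1 - z)) + q * (expR z * (1 + (h - z))) = expR z.
  by rewrite /z; ring.
lra.
Qed.

End HoeffdingLemma.

Section BoundedIntegral.
Context {R : realType} {disp : measure_display} {T : measurableType disp}.
Variable P : probability T R.
Implicit Types f g : T -> R.

Lemma measurable_superlevel f (a : R) : measurable_fun setT f ->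
  measurable [set t | a < f t].
Proof.
move=> mf; have -> : [set t | a < f t] = f @^-1` `]a, +oo[.
  by apply/seteqP; split => t /=; rewrite in_itv/= andbT.
by rewrite -[X in measurable X]setTI; exact: mf.
Qed.

Lemma integrable_bounded f (M : R) : measurable_fun setT f ->
  (forall t, `|f t| <= M) -> P.-integrable setT (EFin \o f).
Proof.
move=> mf fM; apply: measurable_bounded_integrable => //.
  by rewrite (le_lt_trans (probability_le1 _ _))// ltry.
exists M; split; first exact: num_real.
by move=> x Mx t _ /=; rewrite (le_trans (fM t))// ltW.
Qed.

Lemma Rintegral_prob_cst (r : R) : \int[P]_t r = r.
Proof. by rewrite Rintegral_cst// (congr1 fine (probability_setT P)) mulr1. Qed.

Lemma integrable_affine (x y : R) f : P.-integrable setT (EFin \o f) ->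
  P.-integrable setT (EFin \o (fun t => x + y * f t)).
Proof.
move=> intf.
have -> : EFin \o (fun t => x + y * f t) =
    cst x%:E \+ (fun t => y%:E * (f t)%:E)%E.
  by apply/funext => t /=; rewrite EFinD EFinM.
apply: integrableD => //; first exact: finite_measure_integrable_cst.
exact: (integrableZl measurableT y intf).
Qed.

Lemma Rintegral_affine (x y : R) f : P.-integrable setT (EFin \o f) ->
  \int[P]_t (x + y * f t) = x + y * \int[P]_t f t.
Proof.
move=> intf; rewrite RintegralD//.
- by rewrite Rintegral_prob_cst RintegralZl.
- exact: finite_measure_integrable_cst.
- exact: (integrableZl measurableT y intf).
Qed.

Lemma Rintegral_bounds f (a b : R) : measurable_fun setT f ->
  (forall t, a <= f t <= b) -> a <= \int[P]_t f t <= b.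
Proof.
move=> mf fab.
have intf : P.-integrable setT (EFin \o f).
  apply: (@integrable_bounded f (`|a| + `|b|)) => // t.
  have /andP[fa fb] := fab t.
  have := ler_norm b; have := ler_norm (- a); rewrite normrN.
  by have [f0|f0] := ger0P (f t); have := normr_ge0 a; have := normr_ge0 b; lra.
have intc r : P.-integrable setT (EFin \o (fun=> r)).
  exact: finite_measure_integrable_cst.
apply/andP; split.
  rewrite -[leLHS]Rintegral_prob_cst; apply: le_Rintegral => // t _.
  by case/andP: (fab t).
rewrite -[leRHS]Rintegral_prob_cst; apply: le_Rintegral => // t _.
by case/andP: (fab t).
Qed.

(** Hoeffding's lemma. By convexity of the exponential, among the variables
    with a given mean and values in [[a, a + c]] the moment generating function
    is largest for the one carried by the two endpoints. *)
Lemma hoeffding_mgf_le f (a c l : R) : measurable_fun setT f -> 0 < c ->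
  (forall t, a <= f t <= a + c) -> 0 <= l ->
  \int[P]_t expR (l * f t) <= expR (l * \int[P]_t f t + (l * c) ^+ 2 / 8).
Proof.
move=> mf c0 fac l0.
have cn0 : c != 0 by rewrite gt_eqF.
have f_bound t : `|f t| <= `|a| + c.
  have /andP[fa fb] := fac t.
  have := ler_norm a; have := ler_norm (- a); rewrite normrN.
  by have [f0|f0] := ger0P (f t); lra.
have intf := integrable_bounded mf f_bound.
set m := \int[P]_t f t.
have /andP[am mac] : a <= m <= a + c by exact: Rintegral_bounds.
pose A := expR (l * a) * (1 + (a / c) * (1 - expR (l * c))).
pose B := expR (l * a) * ((expR (l * c) - 1) / c).
have chord t : expR (l * f t) <= A + B * f t.
  have /andP[fa fb] := fac t.
  have q01 : 0 <= (f t - a) / c <= 1.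
    by rewrite divr_ge0 ?subr_ge0 ?(ltW c0)//= ler_pdivrMr// mul1r lerBlDl.
  have := ler_wpM2l (expR_ge0 (l * a)) (expR_le_chord (l * c) q01).
  rewrite -expRD; have -> : l * a + (f t - a) / c * (l * c) = l * f t by field.
  move=> /le_trans; apply; rewrite le_eqVlt; apply/orP; left; apply/eqP.
  by rewrite /A /B; field.
have mexp : measurable_fun setT (fun t => expR (l * f t)).
  by apply: measurableT_comp => //; exact: measurable_funM.
have intexp : P.-integrable setT (EFin \o (fun t => expR (l * f t))).
  apply: (@integrable_bounded _ (expR (l * (`|a| + c)))) => // t.
  rewrite ger0_norm ?expR_ge0// ler_expR ler_wpM2l//.
  exact: le_trans (ler_norm _) (f_bound t).
apply: (@le_trans _ _ (\int[P]_t (A + B * f t))).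
  apply: le_Rintegral => //.
  have mAB : measurable_fun setT (fun t => A + B * f t).
    by apply: measurable_funD => //; exact: measurable_funM.
  apply: (@integrable_bounded _ (`|A| + `|B| * (`|a| + c))) => // t.
  rewrite (le_trans (ler_normD _ _))// lerD2l normrM ler_wpM2l//.
rewrite Rintegral_affine// -/m.
have q01 : 0 <= (m - a) / c <= 1.
  by rewrite divr_ge0 ?subr_ge0 ?(ltW c0)//= ler_pdivrMr// mul1r lerBlDl.
have lc0 : 0 <= l * c by rewrite mulr_ge0// ltW.
have := ler_wpM2l (expR_ge0 (l * a)) (bernoulli_mgf_le q01 lc0).
rewrite -expRD.
have -> : l * a + ((m - a) / c * (l * c) + (l * c) ^+ 2 / 8) = l * m + (l * c) ^+ 2 / 8.
  by field.
apply: le_trans; rewrite le_eqVlt; apply/orP; left; apply/eqP.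
by rewrite /A /B; field.
Qed.

End BoundedIntegral.

(** * Independent draws and McDiarmid's inequality *)

Section BoundedFubini.
Context {R : realType} {d1 d2 : measure_display}.
Context {T1 : measurableType d1} {T2 : measurableType d2}.
Variables (P1 : probability T1 R) (P2 : probability T2 R).

Let prod_prob : probability (T1 * T2)%type R := (P1 \x P2)%E.

Lemma measurable_Rintegral2 (f : T1 * T2 -> R) (M : R) : measurable_fun setT f ->
  (forall z, `|f z| <= M) ->
  measurable_fun setT (fun x => \int[P2]_y f (x, y)).
Proof.
move=> mf fM; have intf := integrable_bounded prod_prob mf fM.
exact: (measurableT_comp (@fine_measurable R _ measurableT) (measurable_fubini_F intf)).
Qed.

Lemma Rintegral_prod (f : T1 * T2 -> R) (M : R) : measurable_fun setT f ->
  (forall z, `|f z| <= M) ->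
  \int[prod_prob]_z f z = \int[P1]_x \int[P2]_y f (x, y).
Proof.
move=> mf fM; have intf := integrable_bounded prod_prob mf fM.
rewrite /Rintegral -(integral12_prod_meas1 intf); congr fine.
apply: eq_integral => x _; rewrite /fubini_F /= fineK//.
apply: integrable_fin_num => //.
apply: (@integrable_bounded _ _ _ P2 (fun y => f (x, y)) M) => //.
by apply: measurableT_comp mf _; exact: measurable_pair1.
Qed.

End BoundedFubini.

Lemma Rintegral_distribution {R : realType} {d d' : measure_display}
    {T : measurableType d} {T' : measurableType d'} (P : probability T R)
    (X : {mfun T >-> T'}) (f : T' -> R) : measurable_fun setT f ->
  P.-integrable setT (EFin \o (f \o X)) ->
  \int[distribution P X]_y f y = \int[P]_x f (X x).
Proof.
move=> mf intf; rewrite /Rintegral integral_distribution//.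
exact/measurable_EFinP.
Qed.

Section Boxes.
Context {d : measure_display} {T : measurableType d}.

Definition box (n : nat) (A : 'I_n -> set T) : set (n.-tuple T) :=
  [set t | forall i, A i (tnth t i)].

Lemma measurable_box n (A : 'I_n -> set T) :
  (forall i, measurable (A i)) -> measurable (box A).
Proof.
move=> mA; have -> : box A = \bigcap_i ((tnth (T:=T))^~ i @^-1` A i).
  by apply/seteqP; split => [t tA i _|t tA i]; [exact: tA|exact: (tA i I)].
apply: fin_bigcap_measurable => // i _; rewrite -[X in measurable X]setTI.
exact: (measurable_tnth i measurableT).
Qed.

(** Boxes form a pi-system that generates the product sigma-algebra, so a finite
    measure is determined by its values on them. *)
Lemma eq_measure_boxes {R : realType} n (m1 m2 : {measure set n.-tuple T -> \bar R}) :
  (m1 setT < +oo)%E ->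
  (forall A, (forall i, measurable (A i)) -> m1 (box A) = m2 (box A)) ->
  forall B, measurable B -> m1 B = m2 B.
Proof.
move=> m1fin m12 B mB.
pose G := [set box A | A in [set A : 'I_n -> set T | forall i, measurable (A i)]].
have boxT : box (fun _ : 'I_n => setT) = setT.
  by apply/seteqP; split.
apply: (measure_unique G (fun=> setT)) => //.
- apply/seteqP; split.
    apply: smallest_sub; first exact: smallest_sigma_algebra.
    rewrite -bigcup_seq => C [i _ [A mA <-]]; apply: sub_sigma_algebra.
    exists (fun j => if j == i then A else setT).
      by move=> j /=; case: ifP.
    rewrite setTI; apply/seteqP; split => [t /(_ i)|t /= tA j].
      by rewrite eqxx.
    by case: eqP => [->|].
  apply: smallest_sub; first exact: sigma_algebra_measurable.
  by move=> _ [A mA <-]; exact: measurable_box.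
- move=> _ _ [A mA <-] [A' mA' <-]; exists (fun i => A i `&` A' i).
    by move=> i /=; apply: measurableI; [exact: mA|exact: mA'].
  apply/seteqP; split => [t H|t [H1 H2] i]; last by split.
  by split => i; case: (H i).
- by move=> _; exists (fun=> setT).
- by apply/seteqP; split => // t _; exists 0%N.
- by move=> _ [A mA <-]; exact: m12.
Qed.

End Boxes.

Section IidMeasure.
Context {R : realType} {d : measure_display} {T : measurableType d}.
Variable nu : probability T R.

Definition cons_pair n (p : T * n.-tuple T) : n.+1.-tuple T :=
  [tuple of p.1 :: p.2].

Lemma measurable_cons_pair n : measurable_fun setT (@cons_pair n).
Proof. exact: measurable_cons. Qed.

HB.instance Definition _ n :=
  isMeasurableFun.Build _ _ _ _ (@cons_pair n) (@measurable_cons_pair n).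

(** The [n]-fold power of [nu], built by adding one entry in front, so that
    Fubini's theorem becomes conditioning on the first draw. *)
Fixpoint iid n : probability (n.-tuple T) R :=
  match n return probability (n.-tuple T) R with
  | 0 => \d_[tuple]
  | m.+1 => distribution (nu \x iid m)%E (@cons_pair m)
  end.

Lemma iid_box n (A : 'I_n -> set T) : (forall i, measurable (A i)) ->
  iid n (box A) = (\prod_(i < n) nu (A i))%E.
Proof.
elim: n A => [|n IH] A mA.
  rewrite big_ord0 (_ : box A = setT) ?probability_setT//.
  by apply/seteqP; split => // t _ [].
rewrite big_ord_recl -IH// -product_measure1E//; last exact: measurable_box.
rewrite /= /distribution /pushforward; congr (product_measure1 _ _ _).
apply/seteqP; split => [[x t] /= H|[x t] /= [Ax At] i].
  split; first by have := H ord0; rewrite tnth0.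
  by move=> i; have := H (lift ord0 i); rewrite tnthS.
by case: (unliftP ord0 i) => [j|] ->; rewrite ?tnthS ?tnth0.
Qed.

Lemma Rintegral_iid0 (f : 0.-tuple T -> R) : \int[iid 0]_t f t = f [tuple].
Proof.
rewrite -[RHS](Rintegral_prob_cst (iid 0)).
by apply: eq_Rintegral => t _; rewrite (tuple0 t).
Qed.

Lemma Rintegral_iidS n (f : n.+1.-tuple T -> R) M : measurable_fun setT f ->
  (forall t, `|f t| <= M) ->
  \int[iid n.+1]_t f t = \int[nu]_x \int[iid n]_t f (cons_pair (x, t)).
Proof.
move=> mf fM.
have mfc : measurable_fun setT (f \o @cons_pair n).
  exact: measurableT_comp mf (@measurable_cons_pair n).
rewrite Rintegral_distribution//; last exact: (integrable_bounded _ mfc (fun=> fM _)).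
exact: (Rintegral_prod _ _ mfc (fun=> fM _)).
Qed.

(** The hypothesis of McDiarmid's inequality; one inequality is enough since [t]
    and [t'] can be exchanged. *)
Definition bounded_diff n (c : R) (f : n.-tuple T -> R) :=
  forall (i : 'I_n) (t t' : n.-tuple T),
    (forall j, j != i -> tnth t j = tnth t' j) -> f t <= f t' + c.

(** The exponential moment behind McDiarmid's inequality. Given the first entry
    the induction hypothesis bounds the exponential moment in terms of the
    conditional mean; as a function of the first entry the latter oscillates by
    at most [c], so Hoeffding's lemma applies to it. *)
Lemma bounded_diff_mgf_le n (f : n.-tuple T -> R) (c l M : R) : 0 < c -> 0 <= l ->
  measurable_fun setT f -> (forall t, `|f t| <= M) -> bounded_diff c f ->
  \int[iid n]_t expR (l * f t) <=
    expR (l * \int[iid n]_t f t + n%:R * ((l * c) ^+ 2 / 8)).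
Proof.
move=> c0 l0; elim: n f => [|n IH] f mf fM fc.
  by rewrite !Rintegral_iid0 mul0r addr0.
have mfx x : measurable_fun setT (fun t => f (cons_pair (x, t))).
  apply: (measurableT_comp mf); apply: (measurableT_comp (@measurable_cons_pair n)).
  exact: measurable_pair1.
have mfc : measurable_fun setT (f \o @cons_pair n).
  exact: measurableT_comp mf (@measurable_cons_pair n).
have mexp : measurable_fun setT (fun t => expR (l * f t)).
  by apply: measurableT_comp => //; exact: measurable_funM.
have expM y : `|y| <= M -> `|expR (l * y)| <= expR (l * M).
  move=> yM; rewrite ger0_norm ?expR_ge0// ler_expR ler_wpM2l//.
  exact: le_trans (ler_norm _) yM.
rewrite (Rintegral_iidS mexp (fun t => expM _ (fM t))).
rewrite (Rintegral_iidS mf fM).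
pose m x := \int[iid n]_t f (cons_pair (x, t)).
have mm : measurable_fun setT m.
  exact: (measurable_Rintegral2 nu (iid n) mfc (fun=> fM _)).
have mM x : `|m x| <= M.
  have : - M <= m x <= M.
    by apply: Rintegral_bounds => // t; rewrite -ler_norml.
  by rewrite ler_norml.
have mc x y : m x <= m y + c.
  have -> : m y + c = \int[iid n]_t (c + 1 * f (cons_pair (y, t))).
    rewrite Rintegral_affine ?mul1r 1?addrC//.
    exact: (integrable_bounded _ (mfx y) (fun=> fM _)).
  apply: le_Rintegral => //; first exact: (integrable_bounded _ (mfx x) (fun=> fM _)).
    exact: integrable_affine (integrable_bounded _ (mfx y) (fun=> fM _)).
  move=> t _; rewrite mul1r addrC; apply: (fc ord0) => j j0.
  by case: (unliftP ord0 j) j0 => [k|] ->; rewrite ?eqxx// !tnthS.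
pose a := inf (range m).
have a_lb : has_inf (range m).
  split; first by exists (m point), point.
  by exists (- M) => _ [x _ <-]; have := mM x; rewrite ler_norml => /andP[].
have am x : a <= m x <= a + c.
  apply/andP; split; first by apply: ge_inf; [exact: a_lb.2|exists x].
  rewrite -lerBlDr; apply: lb_le_inf; first exact: a_lb.1.
  by move=> _ [y _ <-]; rewrite lerBlDr.
have := hoeffding_mgf_le nu mm c0 am l0; rewrite -/m.
rewrite -(ler_pM2r (expR_gt0 (n%:R * ((l * c) ^+ 2 / 8)))) -expRD.
have -> : l * \int[nu]_x m x + (l * c) ^+ 2 / 8 + n%:R * ((l * c) ^+ 2 / 8) =
          l * \int[nu]_x m x + n.+1%:R * ((l * c) ^+ 2 / 8).
  by rewrite -natr1; ring.
apply: le_trans.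
have mem : measurable_fun setT (fun x => expR (l * m x)).
  by apply: measurableT_comp => //; exact: measurable_funM.
have intem := integrable_bounded nu mem (fun x => expM _ (mM x)).
rewrite -RintegralZr//; apply: le_Rintegral => //.
- apply: (@integrable_bounded _ _ _ _ _ (expR (l * M))).
    exact: (measurable_Rintegral2 nu (iid n)
      (measurableT_comp mexp (@measurable_cons_pair n)) (fun z => expM _ (fM _))).
  move=> x; rewrite ger0_norm; last by apply: Rintegral_ge0 => t _; exact: expR_ge0.
  have : 0 <= \int[iid n]_t expR (l * f (cons_pair (x, t))) <= expR (l * M).
    apply: Rintegral_bounds.
      by apply: measurableT_comp => //; exact: measurable_funM.
    by move=> t; rewrite expR_ge0 /= (le_trans (ler_norm _))// expM.
  by case/andP.
- under eq_fun do rewrite mulrC.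
  exact: (integrableZl measurableT _ intem).
- move=> x _; rewrite -expRD; apply: IH => // i t t' tt'.
  apply: (fc (lift ord0 i)) => j ji.
  case: (unliftP ord0 j) ji => [k|] -> ki; rewrite ?tnth0// !tnthS.
  by apply: tt'; apply: contra_neq ki => ->.
Qed.

(** McDiarmid's inequality, by Markov's inequality for [expR (l * f)] with the
    optimal [l = 4 e / (n c^2)]. *)
Lemma mcdiarmid n (f : n.-tuple T -> R) (c e M : R) : (0 < n)%N -> 0 < c -> 0 <= e ->
  measurable_fun setT f -> (forall t, `|f t| <= M) -> bounded_diff c f ->
  (iid n [set t | \int[iid n]_s f s + e < f t]%R <=
    (expR (- (2 * e ^+ 2 / (n%:R * c ^+ 2))))%:E)%E.
Proof.
move=> n0 c0 e0 mf fM fc.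
have nn0 : n%:R != 0 :> R by rewrite pnatr_eq0 -lt0n.
have cn0 : c != 0 by rewrite gt_eqF.
set m := \int[iid n]_s f s.
pose l := 4 * e / (n%:R * c ^+ 2).
have l0 : 0 <= l by apply: divr_ge0; apply: mulr_ge0 => //; exact: sqr_ge0.
set A := [set t | _].
have mA : measurable A.
  exact: measurable_superlevel.
have mexp : measurable_fun setT (fun t => expR (l * f t)).
  by apply: measurableT_comp => //; exact: measurable_funM.
have expM t : `|expR (l * f t)| <= expR (l * M).
  rewrite ger0_norm ?expR_ge0// ler_expR ler_wpM2l//.
  exact: le_trans (ler_norm _) (fM t).
have markov : fine (iid n A) * expR (l * (m + e)) <= \int[iid n]_t expR (l * f t).
  have -> : fine (iid n A) = \int[iid n]_t \1_A t.
    by rewrite /Rintegral integral_indic// setIT.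
  rewrite -RintegralZr//; last first.
    apply: (@integrable_bounded _ _ _ _ _ 1) => // t.
    by rewrite ger0_norm// indicE; case: (_ \in _).
  apply: le_Rintegral => //; last 2 first.
  - exact: integrable_bounded mexp expM.
  - move=> t _; rewrite indicE; case: (boolP (t \in A)) => [/set_mem tA|_].
      by rewrite mul1r ler_expR ler_wpM2l// ltW.
    by rewrite mul0r expR_ge0.
  apply: (@integrable_bounded _ _ _ _ _ (expR (l * (m + e)))).
    by apply: measurable_funM.
  move=> t; rewrite normrM (ger0_norm (expR_ge0 _)) ler_piMl ?expR_ge0//.
  by rewrite ger0_norm// indicE; case: (_ \in _).
have fin : iid n A \is a fin_num by exact: fin_num_measure.
rewrite -[X in (X <= _)%E]fineK// lee_fin.
rewrite -(ler_pM2r (expR_gt0 (l * (m + e)))); apply: (le_trans markov).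
apply: (le_trans (bounded_diff_mgf_le c0 l0 mf fM fc)).
rewrite -expRD ler_expR le_eqVlt; apply/orP; left; apply/eqP.
by rewrite -/m /l; field; rewrite nn0 cn0.
Qed.

End IidMeasure.

(** * Uniform deviation of empirical means *)

Section VectorIntegral.
Context {R : realType} {disp : measure_display} {T : measurableType disp}.
Variable P : probability T R.

Lemma integrable_Rintegral_sum (I : Type) (r : seq I) (F : I -> T -> R) :
  (forall i, P.-integrable setT (EFin \o F i)) ->
  P.-integrable setT (EFin \o (fun t => \sum_(i <- r) F i t)) /\
  \int[P]_t (\sum_(i <- r) F i t) = \sum_(i <- r) \int[P]_t F i t.
Proof.
move=> intF; elim: r => [|i r [IHi IHs]].
  split; last by rewrite big_nil; under eq_Rintegral do rewrite big_nil; rewrite Rintegral_prob_cst.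
  under eq_fun do rewrite big_nil; exact: finite_measure_integrable_cst.
split.
  have -> : EFin \o (fun t => \sum_(j <- i :: r) F j t) =
      (EFin \o F i) \+ (EFin \o (fun t => \sum_(j <- r) F j t)).
    by apply/funext => t /=; rewrite big_cons EFinD.
  exact: integrableD.
by under eq_Rintegral do rewrite big_cons; rewrite RintegralD// IHs big_cons.
Qed.

(** Pairing with the integral itself reduces this to the scalar case, through
    the Cauchy-Schwarz inequality. *)
Lemma norm2_Rintegral_le m (Z : T -> 'cV[R]_m) (U : T -> R) :
  (forall i, P.-integrable setT (EFin \o (fun t => Z t i 0))) ->
  P.-integrable setT (EFin \o U) -> (forall t, norm2 (Z t) <= U t) ->
  norm2 (\col_i \int[P]_t Z t i 0) <= \int[P]_t U t.
Proof.
move=> intZ intU ZU; set v := \col_i _.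
have [v0|v0] := eqVneq (norm2 v) 0.
  by rewrite v0; apply: Rintegral_ge0 => t _; exact: le_trans (norm2_ge0 _) (ZU t).
have v_gt0 : 0 < norm2 v by rewrite lt_def v0 norm2_ge0.
rewrite -(ler_pM2l v_gt0) -expr2 sqr_norm2 -RintegralZl//.
have intF i : P.-integrable setT (EFin \o (fun t => v i 0 * Z t i 0)).
  exact: (integrableZl measurableT (v i 0) (intZ i)).
have [intS eqS] := integrable_Rintegral_sum (index_enum _) intF.
have -> : \sum_i v i 0 ^+ 2 = \int[P]_t \sum_i v i 0 * Z t i 0.
  rewrite eqS; apply: eq_bigr => i _.
  by rewrite RintegralZl// expr2; congr (_ * _); rewrite mxE.
apply: le_Rintegral => //; first exact: (integrableZl measurableT _ intU).
move=> t _; apply: (le_trans (dot_le_norm2 _ _)).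
by rewrite ler_wpM2l// norm2_ge0.
Qed.

End VectorIntegral.

Section IidSymmetry.
Context {R : realType} {d : measure_display} {T : measurableType d}.
Variable nu : probability T R.

Lemma Rintegral_eq_law {d' : measure_display} {T' : measurableType d'}
    (m1 m2 : probability T' R) (f : T' -> R) :
  (forall A, measurable A -> m1 A = m2 A) ->
  \int[m1]_t f t = \int[m2]_t f t.
Proof.
by move=> m12; rewrite /Rintegral; congr fine; apply: eq_measure_integral => A mA _; exact: m12.
Qed.

Section Marginal.
Variables (n : nat) (i : 'I_n).

Let coord (t : n.-tuple T) : T := tnth t i.
Let mcoord : measurable_fun setT coord := measurable_tnth i.
HB.instance Definition _ := isMeasurableFun.Build _ _ _ _ coord mcoord.

Lemma Rintegral_iid_tnth (f : T -> R) M : measurable_fun setT f ->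
  (forall t, `|f t| <= M) ->
  \int[iid nu n]_t f (tnth t i) = \int[nu]_x f x.
Proof.
move=> mf fM.
have intf : (iid nu n).-integrable setT (EFin \o (f \o coord)).
  exact: (integrable_bounded _ (measurableT_comp mf mcoord) (fun=> fM _)).
rewrite -(Rintegral_distribution mf intf).
apply: Rintegral_eq_law => A mA.
rewrite -[LHS]/(iid nu n (coord @^-1` A)).
have -> : coord @^-1` A = box (fun j => if j == i then A else setT).
  apply/seteqP; split => [t tA j|t /(_ i)]; last by rewrite eqxx.
  by case: eqP => [->|].
rewrite iid_box; last by move=> j; case: ifP.
rewrite (bigD1 i)//= eqxx big1 ?mule1// => j /negbTE ->.
exact: probability_setT.
Qed.

End Marginal.

(** The two samples [u] and [v] of the symmetrization argument are the mixtures of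
    a sample and its ghost for a sign pattern and for its complement. *)
Definition mix n (b : 'I_n -> bool) (p : n.-tuple T * n.-tuple T) : n.-tuple T :=
  [tuple if b i then tnth p.1 i else tnth p.2 i | i < n].

Lemma measurable_mix n (b : 'I_n -> bool) : measurable_fun setT (mix b).
Proof.
apply/measurable_fun_tnthP => i.
rewrite [X in measurable_fun _ X](_ : _ =
    (fun p => if b i then tnth p.1 i else tnth p.2 i)); last first.
  by apply/funext => p /=; rewrite tnth_mktuple.
by case: (b i); apply: (measurableT_comp (measurable_tnth i)).
Qed.

HB.instance Definition _ n (b : 'I_n -> bool) :=
  isMeasurableFun.Build _ _ _ _ (mix b) (measurable_mix b).

(** Since all draws have the same law, a sample assembled from two independent
    ones is again a sample. *)
Lemma Rintegral_mix n (b : 'I_n -> bool) (f : n.-tuple T -> R) M :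
  measurable_fun setT f -> (forall t, `|f t| <= M) ->
  \int[iid nu n]_t \int[iid nu n]_t' f (mix b (t, t')) = \int[iid nu n]_t f t.
Proof.
move=> mf fM; have mfm := measurableT_comp mf (measurable_mix b).
rewrite -(Rintegral_prod (iid nu n) (iid nu n) mfm (fun=> fM _)).
rewrite -(Rintegral_distribution (P := (iid nu n \x iid nu n)%E) (X := mix b) mf); last first.
  exact: (integrable_bounded _ mfm (fun=> fM _)).
apply: Rintegral_eq_law; apply: eq_measure_boxes => [|A mA].
  by rewrite (le_lt_trans (probability_le1 _ _))// ltry.
pose A1 i := if b i then A i else setT.
pose A2 i := if b i then setT else A i.
have mA1 i : measurable (A1 i) by rewrite /A1; case: ifP.
have mA2 i : measurable (A2 i) by rewrite /A2; case: ifP.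
rewrite -[LHS]/((iid nu n \x iid nu n)%E (mix b @^-1` box A)).
have -> : mix b @^-1` box A = box A1 `*` box A2.
  apply/seteqP; split => [[t t'] /= H|[t t'] /= [H1 H2] i].
    by split => i; have := H i; rewrite /A1 /A2 tnth_mktuple /=; case: (b i).
  by have := H1 i; have := H2 i; rewrite /A1 /A2 tnth_mktuple /=; case: (b i).
rewrite product_measure1E; [|exact: measurable_box..].
transitivity (\prod_(i < n) (nu (A1 i) * nu (A2 i)))%E.
  by rewrite big_split; congr (_ * _)%E; exact: iid_box.
apply: (etrans _ (esym (iid_box nu mA))); apply: eq_bigr => i _.
by rewrite /A1 /A2; case: (b i); rewrite probability_setT ?mule1 ?mul1e.
Qed.

End IidSymmetry.

Section UniformDeviation.
Context {R : realType} {d : measure_display} {T : measurableType d}.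
Variable nu : probability T R.
Variables (I : Type) (X : set I) (m : nat) (g : I -> T -> 'cV[R]_m) (c : R).
Hypothesis X0 : X !=set0.
Hypothesis mg : forall x i, measurable_fun setT (fun t => g x t i 0).
Hypothesis gc : forall x t, norm2 (g x t) <= c.
Variables (K : nat) (b : 'I_K -> bool) (W : K.-tuple T -> R).
Hypothesis K0 : (0 < K)%N.
Hypothesis mW : measurable_fun setT W.
Let sg i : R := if b i then 1 else -1.
Hypothesis WE : forall t,
  supnorm X (fun x => \sum_i sg i *: g x (tnth t i)) = (W t)%:E.

Let nb i := ~~ b i.

Let sg1 i : `|sg i| = 1.
Proof. by rewrite /sg; case: (b i); rewrite ?normrN normr1. Qed.

Let le_W t x : X x -> norm2 (\sum_i sg i *: g x (tnth t i)) <= W t.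
Proof. by move=> Xx; rewrite -lee_fin -WE le_supnorm. Qed.

Let W_le t (y : R) :
  (forall x, X x -> norm2 (\sum_i sg i *: g x (tnth t i)) <= y) -> W t <= y.
Proof. by move=> gy; rewrite -lee_fin -WE supnorm_le. Qed.

Let W_bound t : 0 <= W t <= K%:R * c.
Proof.
rewrite -lee_fin -WE supnorm_ge0//=; apply: W_le => x _.
exact: norm2_signed_sum_le.
Qed.

Let W_norm t : `|W t| <= K%:R * c.
Proof. by have /andP[W0 Wc] := W_bound t; rewrite ger0_norm. Qed.

Let W_diff : bounded_diff (2 * c) W.
Proof.
move=> i t t' tt'; apply: W_le => x Xx.
have -> : \sum_i sg i *: g x (tnth t i) =
    \sum_i sg i *: g x (tnth t' i) + sg i *: (g x (tnth t i) - g x (tnth t' i)).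
  rewrite (bigD1 i)//= [in RHS](bigD1 i)//= scalerBr [RHS]addrC addrA subrK.
  by congr (_ + _); apply: eq_bigr => j ji; rewrite tt'.
apply: (le_trans (ler_norm2D _ _)); apply: lerD; first exact: le_W.
rewrite norm2Z sg1 mul1r (le_trans (ler_norm2B _ _))//.
by rewrite mulrDl mul1r lerD.
Qed.

(** [G] is the measurable function of the sample that bounds the deviation for
    every [x] at once. *)
Let H t t' := W (mix b (t, t')) + W (mix nb (t, t')).
Let G t := K%:R^-1 * \int[iid nu K]_t' H t t'.

Let mH : measurable_fun setT (fun p => H p.1 p.2).
Proof.
rewrite /H; apply: measurable_funD; under eq_fun do rewrite -surjective_pairing.
  exact: (measurableT_comp mW (measurable_mix b)).
exact: (measurableT_comp mW (measurable_mix nb)).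
Qed.

Let mH2 t : measurable_fun setT (H t).
Proof. exact: (measurableT_comp mH (measurable_pair1 t)). Qed.

Let H_bound t t' : `|H t t'| <= 2 * (K%:R * c).
Proof. by rewrite (le_trans (ler_normD _ _))// mulrDl mul1r lerD. Qed.

Let intH t : (iid nu K).-integrable setT (EFin \o H t).
Proof. exact: integrable_bounded (mH2 t) (H_bound t). Qed.

Let intH_norm t : `|\int[iid nu K]_t' H t t'| <= 2 * (K%:R * c).
Proof.
have : - (2 * (K%:R * c)) <= \int[iid nu K]_t' H t t' <= 2 * (K%:R * c).
  by apply: Rintegral_bounds => // t'; rewrite -ler_norml.
by rewrite ler_norml.
Qed.

Let mG0 : measurable_fun setT (fun t => \int[iid nu K]_t' H t t').
Proof. exact: (measurable_Rintegral2 (iid nu K) (iid nu K) mH (fun=> H_bound _ _)). Qed.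

Let G_mean : \int[iid nu K]_t G t = 2 / K%:R * \int[iid nu K]_t W t.
Proof.
rewrite RintegralZl//; last exact: integrable_bounded mG0 intH_norm.
rewrite mulrAC [in RHS]mulrC; congr (_ * _).
have mWm b' : measurable_fun setT (fun p => W (mix b' p)).
  exact: (measurableT_comp mW (measurable_mix b')).
have mWm2 b' t : measurable_fun setT (fun t' => W (mix b' (t, t'))).
  exact: (measurableT_comp (mWm b') (measurable_pair1 t)).
have i1 b' t : (iid nu K).-integrable setT (EFin \o (fun t' => W (mix b' (t, t')))).
  exact: integrable_bounded (mWm2 b' t) (fun=> W_norm _).
have i2 b' : (iid nu K).-integrable setT
    (EFin \o (fun t => \int[iid nu K]_t' W (mix b' (t, t')))).
  apply: (@integrable_bounded _ _ _ _ _ (K%:R * c)).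
    exact: (measurable_Rintegral2 (iid nu K) (iid nu K) (mWm b') (fun=> W_norm _)).
  move=> t; rewrite ger0_norm; last first.
    by apply: Rintegral_ge0 => t' _; case/andP: (W_bound (mix b' (t, t'))).
  by case/andP: (Rintegral_bounds (iid nu K) (mWm2 b' t) (fun=> W_bound _)).
under eq_Rintegral do rewrite RintegralD//.
by rewrite RintegralD// !(Rintegral_mix _ _ mW W_norm) mulrDl mul1r.
Qed.

Let G_diff : bounded_diff (2 * c / K%:R) G.
Proof.
move=> i t u tu; rewrite /G [2 * c / _]mulrC -mulrDr ler_wpM2l// ?invr_ge0//.
have -> : \int[iid nu K]_t' H u t' + 2 * c = \int[iid nu K]_t' (2 * c + 1 * H u t').
  by rewrite Rintegral_affine// mul1r addrC.
apply: le_Rintegral => //.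
  exact: integrable_affine.
(* the entry [i] of [t] enters exactly one of the two mixed samples *)
move=> t' _; rewrite mul1r /H.
have mix_eq b' : ~~ b' i -> mix b' (t, t') = mix b' (u, t').
  move=> b'i; apply: eq_from_tnth => j; rewrite !tnth_mktuple /=.
  by have [->|ji] := eqVneq j i; [rewrite (negbTE b'i)|rewrite (tu _ ji)].
have mix_diff b' : W (mix b' (t, t')) <= W (mix b' (u, t')) + 2 * c.
  by apply: (W_diff (i := i)) => j ji; rewrite !tnth_mktuple /= tu.
have [bi|bi] := boolP (b i).
  rewrite (mix_eq nb) ?/nb ?bi//; have := mix_diff b; lra.
rewrite (mix_eq b)//; have := mix_diff nb; lra.
Qed.

(** Symmetrization, in pointwise form: the mean is the integral over an
    independent ghost sample, and the difference of the two sums is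
    the difference of the signed sums over the two mixed samples. *)
Let deviation_le_G t x : X x ->
  norm2 (K%:R^-1 *: \sum_i g x (tnth t i) - \col_j \int[nu]_y g x y j 0) <= G t.
Proof.
move=> Xx.
have Kn0 : K%:R != 0 :> R by rewrite pnatr_eq0 -lt0n.
have gj y j : `|g x y j 0| <= c by exact: le_trans (ler_coord_norm2 _ _) (gc _ _).
pose Z (t' : K.-tuple T) : 'cV[R]_m := K%:R^-1 *: (\sum_i g x (tnth t i) - \sum_i g x (tnth t' i)).
have intg i j : (iid nu K).-integrable setT (EFin \o (fun t' => g x (tnth t' i) j 0)).
  exact: (integrable_bounded _ (measurableT_comp (mg x j) (measurable_tnth i)) (fun=> gj _ _)).
have ints j := integrable_Rintegral_sum (index_enum _) (intg^~ j).
have ZE t' j : Z t' j 0 =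
    K%:R^-1 * (\sum_i g x (tnth t i)) j 0 + (- K%:R^-1) * \sum_i g x (tnth t' i) j 0.
  by rewrite !mxE !summxE; ring.
have -> : K%:R^-1 *: \sum_i g x (tnth t i) - \col_j \int[nu]_y g x y j 0 =
    \col_j \int[iid nu K]_t' Z t' j 0.
  apply/colP => j; rewrite [RHS]mxE.
  under eq_Rintegral do rewrite ZE.
  rewrite Rintegral_affine; last exact: (ints j).1.
  rewrite (ints j).2.
  rewrite (eq_bigr (fun=> \int[nu]_y g x y j 0)); last first.
    by move=> i _; exact: (Rintegral_iid_tnth _ _ (mg x j) (gj^~ j)).
  rewrite sumr_const card_ord !mxE; set y := Rintegral _ _ _.
  by rewrite -[y *+ K]mulr_natr; field.
rewrite /G -RintegralZl//; apply: norm2_Rintegral_le.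
- move=> j; under eq_fun do rewrite ZE.
  exact: integrable_affine (ints j).1.
- exact: (integrableZl measurableT _ (intH t)).
- move=> t'; rewrite /Z norm2Z ger0_norm ?invr_ge0// ler_wpM2l ?invr_ge0//.
  have -> : \sum_i g x (tnth t i) - \sum_i g x (tnth t' i) =
      \sum_i sg i *: g x (tnth (mix b (t, t')) i) -
      \sum_i sg i *: g x (tnth (mix nb (t, t')) i).
    rewrite -!sumrB; apply: eq_bigr => i _; rewrite !tnth_mktuple /sg /nb /=.
    by case: (b i); rewrite ?scale1r// !scaleN1r opprK addrC.
  by apply: (le_trans (ler_norm2B _ _)); apply: lerD; exact: le_W.
Qed.

(** The empirical mean of a bounded family is uniformly close to its
    expectation, with a deviation governed by the signed sums for one fixed
    choice of signs. McDiarmid's inequality is applied to [G] and not to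
    the supremum of the deviations, which may fail to be measurable. *)
Lemma uniform_deviation (L : R) : 0 <= L ->
  exists A, [/\ measurable A, (iid nu K A <= (expR (- L))%:E)%E &
    forall t, ~ A t -> forall x, X x ->
      norm2 (K%:R^-1 *: \sum_i g x (tnth t i) - \col_j \int[nu]_y g x y j 0) <=
      2 / K%:R * \int[iid nu K]_t W t + Num.sqrt 2 * c * Num.sqrt (L / K%:R)].
Proof.
move=> L0; have Kn0 : K%:R != 0 :> R by rewrite pnatr_eq0 -lt0n.
set e := Num.sqrt 2 * c * Num.sqrt (L / K%:R).
have c_ge0 : 0 <= c by have [x _] := X0; exact: le_trans (norm2_ge0 _) (gc x point).
have e0 : 0 <= e by rewrite !mulr_ge0 ?sqrtr_ge0.
have mG : measurable_fun setT G by exact: measurable_funM.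
have GM t : `|G t| <= K%:R^-1 * (2 * (K%:R * c)).
  by rewrite normrM ger0_norm ?invr_ge0// ler_wpM2l ?invr_ge0.
have [c0|c0] := eqVneq c 0.
  (* McDiarmid's inequality divides by the range, but here [G] vanishes *)
  exists set0; split; rewrite ?measure0 ?lee_fin ?expR_ge0// => t _ x Xx.
  apply: (le_trans (deviation_le_G t Xx)).
  have := GM t; rewrite c0 !mulr0 normr_le0 => /eqP ->.
  by rewrite addr_ge0// mulr_ge0 ?divr_ge0// Rintegral_ge0// => s _; case/andP: (W_bound s).
have c_gt0 : 0 < c by rewrite lt_def c0.
exists [set t | 2 / K%:R * \int[iid nu K]_s W s + e < G t]; split.
- exact: measurable_superlevel.
- have cK : 0 < 2 * c / K%:R by rewrite divr_gt0 ?mulr_gt0 ?ltr0n.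
  have := mcdiarmid nu K0 cK e0 mG GM G_diff.
  rewrite G_mean => /le_trans; apply; rewrite lee_fin ler_expR lerN2.
  rewrite le_eqVlt; apply/orP; left; apply/eqP.
  rewrite /e !exprMn !sqr_sqrtr ?divr_ge0//.
  by field; rewrite Kn0 c0.
- move=> t /negP; rewrite -leNgt => Gt x Xx.
  exact: le_trans (deviation_le_G t Xx) Gt.
Qed.

End UniformDeviation.

(** * Samples, random signs and tails *)

(** The integral of a nonnegative function is defined as a supremum over the
    simple functions below it, so monotonicity holds for arbitrary functions. It
    is used for the Rademacher integrand, which is only controlled on the event
    where all signs are [1] or [-1] and all draws are regular. *)
Lemma ge0_le_integral_nonmeasurable {R : realType} {d : measure_display} {T : measurableType d}
    (mu : {measure set T -> \bar R}) (f g : T -> \bar R) :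
  (forall x, 0 <= f x)%E -> (forall x, f x <= g x)%E ->
  (\int[mu]_x f x <= \int[mu]_x g x)%E.
Proof.
move=> f0 fg; have g0 x : (0 <= g x)%E by exact: le_trans (fg x).
rewrite !ge0_integralTE//; apply: le_ereal_sup => _ [h hf <-].
by exists h => //= x; exact: le_trans (hf x) (fg x).
Qed.

Lemma measure_bigsetU_le {R : realType} {d : measure_display} {T : measurableType d}
    (mu : {measure set T -> \bar R}) (I : Type) (r : seq I) (F : I -> set T) :
  (forall i, measurable (F i)) ->
  (mu (\big[setU/set0]_(i <- r) F i) <= \sum_(i <- r) mu (F i))%E.
Proof.
move=> mF; elim: r => [|i r IH]; first by rewrite !big_nil measure0.
rewrite !big_cons; apply: (le_trans (measureU2 _ (mF i) _)).
  exact: bigsetU_measurable.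
by rewrite leeD2l.
Qed.

Section SampleLaw.
Context {R : realType} {dT dO : measure_display}.
Context {Theta : measurableType dT} {Omega : measurableType dO}.
Variables (nu : probability Theta R) (P : probability Omega R).
Variables (K : nat) (theta : 'I_K -> Omega -> Theta) (eps : 'I_K -> Omega -> R).
Hypothesis htheta : forall i, has_law P (theta i) nu.
Hypothesis heps : forall i, rademacher P (eps i).
Hypothesis hindep : mutually_independent P theta eps.

Definition sample (w : Omega) : K.-tuple Theta := [tuple theta i w | i < K].

Lemma measurable_sample : measurable_fun setT sample.
Proof.
apply/measurable_fun_tnthP => i.
rewrite [X in measurable_fun _ X](_ : _ = theta i); first by case: (htheta i).
by apply/funext => w /=; rewrite tnth_mktuple.
Qed.

Let measurable_preim_theta i A : measurable A -> measurable (theta i @^-1` A).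
Proof. by move=> mA; rewrite -[X in measurable X]setTI; exact: (htheta i).1. Qed.

(** On an event [E] that is independent of the sample, the integral factorizes;
    independence is only asked of boxes, which generate. *)
Lemma integral_sample (E : set Omega) (p : {nonneg R}) (f : K.-tuple Theta -> \bar R) :
  measurable E ->
  (forall A, (forall i, measurable (A i)) ->
     P (sample @^-1` box A `&` E) = (p%:num%:E * \prod_(i < K) nu (A i))%E) ->
  measurable_fun setT f -> (forall t, 0 <= f t)%E ->
  (\int[P]_(w in E) f (sample w) = p%:num%:E * \int[iid nu K]_t f t)%E.
Proof.
move=> mE HE mf f0.
have mfs : measurable_fun setT (fun w => f (sample w)).
  exact: measurableT_comp mf measurable_sample.
transitivity (\int[mrestr P mE]_(w in E) f (sample w))%E.
  by apply: eq_measure_integral => A mA AE; rewrite -[RHS]/(P (A `&` E)) (setIidl AE).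
transitivity (\int[mrestr P mE]_w f (sample w))%E.
  rewrite [RHS](@ge0_negligible_integral _ _ _ _ _ (~` E))//.
  - by rewrite setDE setCK setTI.
  - exact: measurableC.
  - by rewrite -[LHS]/(P (~` E `&` E)) setICl measure0.
transitivity (\int[pushforward (mrestr P mE) sample]_t f t)%E.
  by rewrite (ge0_integral_pushforward measurable_sample).
rewrite -ge0_integral_mscale//; apply: eq_measure_integral; first exact: measurable_sample.
move=> msm B mB _; apply: eq_measure_boxes mB => [|A mA].
  by rewrite (le_lt_trans (probability_le1 P (measurableI _ _ measurableT mE)))// ltry.
rewrite -[LHS]/(P (sample @^-1` box A `&` E)) HE// -[RHS]/(_ * iid nu K (box A))%E.
by congr (_ * _)%E; rewrite -(iid_box nu mA).
Qed.

Lemma sample_preim_box (A : 'I_K -> set Theta) :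
  sample @^-1` box A = \bigcap_i (theta i @^-1` A i).
Proof.
apply/seteqP; split => [w H i _|w H i].
  by have := H i; rewrite tnth_mktuple.
by rewrite tnth_mktuple; exact: (H i I).
Qed.

Lemma prob_sample (B : set (K.-tuple Theta)) : measurable B ->
  P (sample @^-1` B) = iid nu K B.
Proof.
move=> mB; apply: (@eq_measure_boxes _ _ _ _
  (pushforward P sample) (iid nu K)) => //.
- exact: measurable_sample.
- by move=> msm; rewrite (le_lt_trans (probability_le1 P measurableT))// ltry.
- move=> msm A mA; apply: (etrans _ (esym (iid_box nu mA))).
  rewrite -[LHS]/(P (sample @^-1` box A)) sample_preim_box.
  have := hindep mA (fun _ : 'I_K => measurableT).
  rewrite (_ : \bigcap_j (eps j @^-1` setT) = setT); last by apply/seteqP; split.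
  rewrite setIT => ->; rewrite [X in (_ * X)%E]big1 ?mule1.
    by apply: eq_bigr => i _; exact: (htheta i).2.
  by move=> j _; rewrite preimage_setT probability_setT.
Qed.

Let sgn (b : bool) : R := if b then 1 else -1.

Section Signs.
Variable D : set Theta.
Hypotheses (mD : measurable D) (nuD : nu (~` D) = 0%E).
Variable W : {ffun 'I_K -> bool} -> K.-tuple Theta -> R.
Hypothesis mW : forall s, measurable_fun setT (W s).
Variable M : R.
Hypothesis WM : forall s t, 0 <= W s t <= M.
Variable S : Omega -> \bar R.
Hypothesis S0 : forall w, (0 <= S w)%E.
Hypothesis SE : forall w (s : {ffun 'I_K -> bool}), (forall i, D (theta i w)) ->
  (forall i, eps i w = sgn (s i)) -> S w = (W s (sample w))%:E.

Let E (s : {ffun 'I_K -> bool}) : set Omega :=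
  \bigcap_i (theta i @^-1` D) `&` \bigcap_j (eps j @^-1` [set sgn (s j)]).

Let mE s : measurable (E s).
Proof.
apply: measurableI; apply: fin_bigcap_measurable => // i _.
  exact: measurable_preim_theta.
rewrite -[X in measurable X]setTI; case: (heps i) => me _ _.
exact: (me measurableT _ (measurable_set1 _)).
Qed.

Let p : {nonneg R} := ((2 ^ K)%:R^-1)%:nng.

Let prob_E s (A : 'I_K -> set Theta) : (forall i, measurable (A i)) ->
  P (sample @^-1` box A `&` E s) = (p%:num%:E * \prod_(i < K) nu (A i))%E.
Proof.
move=> mA; rewrite sample_preim_box /E setIA -bigcapI.
rewrite (_ : \bigcap_i _ = \bigcap_i (theta i @^-1` (A i `&` D))); last first.
  by apply/seteqP; split.
rewrite (hindep (fun i => measurableI _ _ (mA i) mD) (fun j => measurable_set1 _)).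
rewrite muleC; congr (_ * _)%E.
  rewrite (eq_bigr (fun=> (2^-1)%:E)) => [|j _]; last first.
    by case: (heps j) => _ h1 h2; rewrite /sgn; case: (s j).
  rewrite prodEFin prodr_const card_ord; congr EFin.
  by rewrite /= natrX exprVn.
apply: eq_bigr => i _; rewrite (htheta i).2; last exact: measurableI.
rewrite [RHS](measureDI nu (mA i) mD) [X in (X + _)%E](_ : _ = 0%E) ?add0e//.
apply: (subset_measure0 (measurableD (mA i) mD) (measurableC mD) _ nuD).
by move=> x [].
Qed.

(** The signs take each of the [2 ^ K] patterns with equal probability and
    independently of the sample, so the expectation over the signs is at least
    the expectation for the pattern where the latter is smallest. The events [E s]
    need not cover the whole space, since the signs are only almost surely [1] or
    [-1] and the draws only almost surely in [D]; [S] is nonnegative elsewhere. *)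
Lemma exists_signs_le : exists s,
  ((\int[iid nu K]_t W s t)%:E <= \int[P]_w S w)%E.
Proof.
pose J s := \int[iid nu K]_t W s t.
have mWE s : measurable_fun setT (fun t => (W s t)%:E) by exact/measurable_EFinP.
have intW s : (iid nu K).-integrable setT (EFin \o W s).
  apply: (@integrable_bounded _ _ _ _ _ M) => // t.
  by have /andP[W0 WMt] := WM s t; rewrite ger0_norm.
have JE s : ((J s)%:E = \int[iid nu K]_t (W s t)%:E)%E.
  by rewrite /J /Rintegral fineK//; exact: (integrable_fin_num measurableT (intW s)).
pose f s := (fun w => (W s (sample w))%:E) \_ (E s).
have f0 s w : (0 <= f s w)%E.
  by rewrite /f patchE; case: ifP => // _; rewrite lee_fin; case/andP: (WM s (sample w)).
have fS w : (\sum_s f s w <= S w)%E.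
  have [[s Es]|nE] := pselect (exists s, E s w); last first.
    rewrite big1// => s _; rewrite /f patchE memNset// => Es; apply: nE; by exists s.
  rewrite (bigD1 s)//= big1 => [|u us].
    rewrite adde0 /f patchE mem_set// (SE (s := s))//.
      by move=> i; exact: (Es.1 i I).
    by move=> i; exact: (Es.2 i I).
  rewrite /f patchE memNset// => Eu; move/negP: us; apply; apply/eqP/ffunP => j.
  have := Es.2 j I; rewrite /= (Eu.2 j I) /sgn.
  by case: (u j) (s j) => [] [] // H; exfalso; lra.
have intf s : (\int[P]_w f s w = (p%:num * J s)%:E)%E.
  rewrite -integral_mkcond EFinM JE; apply: (@integral_sample (E s) p (fun t => (W s t)%:E)) => //.
  - by move=> A mA; exact: prob_E.
  - by move=> t; rewrite lee_fin; case/andP: (WM s t).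
have mf s : measurable_fun setT (f s).
  apply/(measurable_restrictT _ (mE s)); apply: measurable_funTS.
  exact: measurableT_comp (mWE s) measurable_sample.
have le_S : ((\sum_s p%:num * J s)%:E <= \int[P]_w S w)%E.
  rewrite -sumEFin; under eq_bigr do rewrite -intf.
  rewrite -ge0_integral_sum//; apply: ge0_le_integral_nonmeasurable => // w.
  exact: sume_ge0.
have [s _ sJ] := @Order.TotalTheory.arg_minP _ R _ [ffun=> true] xpredT J isT.
exists s; apply: le_trans le_S; rewrite lee_fin -/(J s).
have -> : J s = \sum_(u : {ffun 'I_K -> bool}) p%:num * J s.
  have pK : p%:num * (2 ^ K)%:R = 1.
    by rewrite /= mulVf// pnatr_eq0 -lt0n expn_gt0.
  by rewrite sumr_const card_ffun card_bool card_ord -[RHS]mulr_natr mulrAC pK mul1r.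
by apply: ler_sum => u _; rewrite ler_wpM2l//; exact: sJ.
Qed.

End Signs.

End SampleLaw.

Section TruncationBias.
Context {R : realType} {disp : measure_display} {T : measurableType disp}.
Variable P : probability T R.

(** Cauchy-Schwarz for [f] against the indicator of a tail event, obtained from
    the inequalities [2 f <= k f^2 + 1 / k] over all scales [k]. *)
Lemma tail_moment_le (f : T -> R) (b V q : R) :
  measurable_fun setT f -> (forall t, 0 <= f t) -> 0 <= V -> 0 < q ->
  (\int[P]_t (f t ^+ 2)%:E <= V%:E)%E -> (P [set t | b < f t]%R <= q%:E)%E ->
  P.-integrable setT (EFin \o (fun t => f t * \1_[set t | b < f t] t)) /\
  \int[P]_t (f t * \1_[set t | b < f t] t) <= Num.sqrt (q * V).
Proof.
move=> mf f0 V0 q0 fV fq.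
set A := [set t | _] in fq *.
have mA : measurable A.
  exact: measurable_superlevel.
have mf2 : measurable_fun setT (fun t => f t ^+ 2).
  by under eq_fun do rewrite expr2; exact: measurable_funM.
have int2 : P.-integrable setT (EFin \o (fun t => f t ^+ 2)).
  apply/integrableP; split; first exact/measurable_EFinP.
  apply: (le_lt_trans _ (ltry V)); apply: le_trans fV.
  rewrite le_eqVlt; apply/orP; left; apply/eqP; apply: eq_integral => t _.
  by rewrite /= ger0_norm// sqr_ge0.
have intA : P.-integrable setT (EFin \o \1_A).
  apply: (@integrable_bounded _ _ _ _ _ 1) => // t.
  by rewrite ger0_norm// indicE; case: (_ \in _).
have intk k : P.-integrable setT (EFin \o (fun t => k / 2 * f t ^+ 2 + (2 * k)^-1 * \1_A t)).
  have -> : EFin \o (fun t => k / 2 * f t ^+ 2 + (2 * k)^-1 * \1_A t) =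
      ((fun t => (k / 2)%:E * (f t ^+ 2)%:E) \+ (fun t => (2 * k)^-1%:E * (\1_A t)%:E))%E.
    by apply/funext => t /=; rewrite EFinD !EFinM.
  apply: integrableD => //; first exact: (integrableZl measurableT (k / 2) int2).
  exact: (integrableZl measurableT (2 * k)^-1 intA).
have young k t : 0 < k ->
    f t * \1_A t <= k / 2 * f t ^+ 2 + (2 * k)^-1 * \1_A t.
  move=> k0; rewrite indicE; case: (_ \in _); last first.
    by rewrite !mulr0 addr0 mulr_ge0 ?sqr_ge0// divr_ge0// ltW.
  rewrite !mulr1 -subr_ge0.
  have -> : k / 2 * f t ^+ 2 + (2 * k)^-1 - f t = (k * f t - 1) ^+ 2 / (2 * k).
    by field; rewrite gt_eqF.
  by rewrite divr_ge0 ?sqr_ge0// mulr_ge0// ltW.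
have intU : P.-integrable setT (EFin \o (fun t => f t * \1_A t)).
  apply: (le_integrable measurableT _ _ (intk 1)).
    by apply/measurable_EFinP; apply: measurable_funM.
  move=> t _; rewrite /= lee_fin ger0_norm; last by rewrite mulr_ge0.
  exact: le_trans (young 1 t ltr01) (ler_norm _).
split=> //; apply/ler_addgt0Pr => e e0.
set r := Num.sqrt _; have r0 : 0 <= r by exact: sqrtr_ge0.
have y0 : 0 < r + e by rewrite ltr_wpDl.
(* the scale that balances the two terms, up to the slack [e] *)
pose k := q / (r + e); have k0 : 0 < k by rewrite divr_gt0.
have Vle : \int[P]_t (f t ^+ 2) <= V.
  by rewrite -lee_fin fineK//; exact: integrable_fin_num.
have qle : \int[P]_t \1_A t <= q.
  rewrite /Rintegral integral_indic// setIT -lee_fin fineK//.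
  exact: fin_num_measure.
apply: (@le_trans _ _ (\int[P]_t (k / 2 * f t ^+ 2 + (2 * k)^-1 * \1_A t))).
  by apply: le_Rintegral => // t _; exact: young.
rewrite RintegralD//; last 2 first.
  exact: (integrableZl measurableT (k / 2) int2).
  exact: (integrableZl measurableT (2 * k)^-1 intA).
rewrite !RintegralZl//.
have h1 : k / 2 * \int[P]_t (f t ^+ 2) <= k / 2 * V by rewrite ler_wpM2l// divr_ge0// ltW.
have h2 : (2 * k)^-1 * \int[P]_t \1_A t <= (2 * k)^-1 * q.
  by rewrite ler_wpM2l// invr_ge0 mulr_ge0// ltW.
have r2 : r ^+ 2 = q * V by rewrite sqr_sqrtr// mulr_ge0// ltW.
have h3 : k / 2 * V <= (r + e) / 2.
  have -> : k / 2 * V = r ^+ 2 / (r + e) / 2 by rewrite r2 /k; field; rewrite gt_eqF.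
  rewrite ler_pM2r// ler_pdivrMr// -expr2.
  by rewrite lerXn2r ?nnegrE ?(ltW y0)// lerDl ltW.
have h4 : (2 * k)^-1 * q = (r + e) / 2.
  by rewrite /k; field; rewrite !gt_eqF.
lra.
Qed.

Lemma eq_ae_Rintegral (f g : T -> R) (D : set T) : measurable D -> P (~` D) = 0%E ->
  measurable_fun setT f -> measurable_fun setT g ->
  (forall t, D t -> f t = g t) -> \int[P]_t f t = \int[P]_t g t.
Proof.
move=> mD PD mf mg fg; rewrite /Rintegral; congr fine.
apply: ae_eq_integral => //; [exact/measurable_EFinP|exact/measurable_EFinP|].
exists (~` D); split => //; first exact: measurableC.
by move=> t /= H Dt; apply: H => _; rewrite fg.
Qed.

End TruncationBias.

(** * Random features *)

Section RandomFeatures.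
Context {R : realType} {n d d1 : nat} {disp : measure_display}.
Context {Theta : measurableType disp}.
Variable nu : probability Theta R.
Variable Phi : 'cV[R]_n -> Theta -> 'M[R]_(d, d1).
Hypothesis hPhi : measurable_feature_map Phi.

Lemma measurable_truncate (b : R) x i j :
  measurable_fun setT (fun t => truncate Phi b x t i j).
Proof.
rewrite [X in measurable_fun _ X](_ : _ =
    (fun t => if opnorm (Phi x t) <= b then Phi x t i j else 0)); last first.
  by apply/funext => t; rewrite /truncate; case: ifP => // _; rewrite mxE.
apply: measurable_fun_ifT => //.
by apply: measurable_fun_ler => //; exact: measurable_opnorm (hPhi x).
Qed.

Lemma norm2_truncate_le (b c : R) x t (v : 'cV[R]_d1) : 0 <= b ->
  norm2 v <= c -> norm2 (truncate Phi b x t *m v) <= b * c.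
Proof.
move=> b0 vc; rewrite /truncate; case: ifPn => [Pb|_].
  rewrite (le_trans (norm2_mulmx_le _ _))//.
  by apply: ler_pM => //; [exact: opnorm_ge0|exact: norm2_ge0].
by rewrite mul0mx norm2_0 mulr_ge0// (le_trans (norm2_ge0 v)).
Qed.

Variables (Bh : R) (alpha : Theta -> 'cV[R]_d1) (h : 'cV[R]_n -> 'cV[R]_d).
Hypothesis halpha : represents nu Phi Bh alpha h.

Lemma represents_bound_ae : nu (~` [set t | norm2 (alpha t) <= Bh]) = 0%E.
Proof.
have [malpha /ess_supP [N [mN nuN DN]] _] := halpha.
apply: (subset_measure0 _ mN _ nuN) => [|t Dt].
  apply: measurableC; rewrite -[X in measurable X]setTI.
  by apply: measurable_fun_le => //; exact: measurable_norm2.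
by apply: DN => /=; rewrite lee_fin.
Qed.

(** The price of truncation. Up to a null set, the integrands differ only where
    the norm of the feature exceeds [b], and there by at most [Bh] times that
    norm. *)
Lemma truncation_bias_le (b v q : R) (r : Theta -> Theta) x :
  0 <= Bh -> 0 <= b -> 0 <= v -> 0 < q -> measurable_fun setT r ->
  (forall t, norm2 (alpha t) <= Bh -> r t = t) ->
  (forall t, norm2 (alpha (r t)) <= Bh) ->
  (\int[nu]_t (opnorm (Phi x t) ^+ 2)%:E <= v%:E)%E ->
  (nu [set t | b < opnorm (Phi x t)]%R <= q%:E)%E ->
  norm2 (\col_j \int[nu]_t (truncate Phi b x (r t) *m alpha (r t)) j 0 - h x) <=
  Bh * Num.sqrt (q * v).
Proof.
move=> Bh0 b0 v0 q0 mr rD Dr hv tail.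
have [malpha _ hint] := halpha.
have mop := measurable_opnorm (hPhi x).
have mnalpha := measurable_norm2 malpha.
have [intU Ule] := tail_moment_le mop (fun t => opnorm_ge0 _) v0 q0 hv tail.
set U := fun t => _ in intU Ule.
pose g t := truncate Phi b x (r t) *m alpha (r t).
have mg j : measurable_fun setT (fun t => g t j 0).
  apply: measurable_mulmx => [k l|k].
    exact: (measurableT_comp (measurable_truncate b x k l) mr).
  exact: (measurableT_comp (malpha k) mr).
pose F t := g t - Phi x t *m alpha t.
pose Z t : 'cV[R]_d := if norm2 (alpha t) <= Bh then F t else 0.
have mPa j : measurable_fun setT (fun t => (Phi x t *m alpha t) j 0).
  by apply: measurable_mulmx; [exact: hPhi|exact: malpha].
have mF j : measurable_fun setT (fun t => F t j 0).
  under eq_fun do rewrite /F mxE [X in _ + X]mxE.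
  exact: measurable_funB.
have mZ j : measurable_fun setT (fun t => Z t j 0).
  rewrite [X in measurable_fun _ X](_ : _ =
      (fun t => if norm2 (alpha t) <= Bh then F t j 0 else 0)); last first.
    by apply/funext => t; rewrite /Z; case: ifP => // _; rewrite mxE.
  by apply: measurable_fun_ifT => //; exact: measurable_fun_ler.
have ZU t : norm2 (Z t) <= Bh * U t.
  rewrite /Z; case: ifPn => [Dt|_]; last first.
    by rewrite norm2_0 mulr_ge0// /U mulr_ge0 ?opnorm_ge0// indicE.
  rewrite /F /g rD// /truncate /U indicE.
  case: ifPn => [ob|]; first by rewrite subrr norm2_0 !mulr_ge0 ?opnorm_ge0.
  rewrite -ltNge => ob; rewrite mem_set//= mulr1 mul0mx sub0r norm2N.
  rewrite (le_trans (norm2_mulmx_le _ _))// mulrC.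
  by rewrite ler_wpM2r// opnorm_ge0.
have intBU : nu.-integrable setT (EFin \o (fun t => Bh * U t)).
  exact: (integrableZl measurableT Bh intU).
have intZ j : nu.-integrable setT (EFin \o (fun t => Z t j 0)).
  apply: (le_integrable measurableT _ _ intBU); first exact/measurable_EFinP.
  move=> t _; rewrite /= lee_fin (le_trans (ler_coord_norm2 _ _))//.
  exact: le_trans (ZU t) (ler_norm _).
have -> : \col_j \int[nu]_t g t j 0 - h x = \col_j \int[nu]_t Z t j 0.
  apply/colP => j; rewrite !mxE.
  rewrite [RHS](@eq_ae_Rintegral _ _ _ _ _ (fun t => F t j 0) [set t | norm2 (alpha t) <= Bh])//.
  - have [intPa ->] := hint x j.
    rewrite -RintegralB//; last first.
      apply: (@integrable_bounded _ _ _ _ _ (b * Bh)) => // t.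
      exact: le_trans (ler_coord_norm2 _ _) (norm2_truncate_le _ _ b0 (Dr t)).
    by apply: eq_Rintegral => t _; rewrite [RHS]mxE [X in _ = _ + X]mxE.
  - by rewrite -[X in measurable X]setTI; exact: measurable_fun_le.
  - exact: represents_bound_ae.
  - by move=> t; rewrite /Z /= => ->.
apply: (le_trans (norm2_Rintegral_le intZ intBU ZU)).
by rewrite RintegralZl// ler_wpM2l.
Qed.

End RandomFeatures.

Theorem proposition5p1 (R : realType) (n d d1 : nat) (hd : (d1 <= d)%N)
    (dT : measure_display) (Theta : measurableType dT)
    (nu : probability Theta R)
    (Phi : 'cV[R]_n -> Theta -> 'M[R]_(d, d1))
    (hPhi : measurable_feature_map Phi)
    (X : set 'cV[R]_n) (hX : compact X)
    (BPhi : R -> R) (hBPhi : feature_tail_bound nu Phi X BPhi)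
    (delta : R) (hdelta : 0 < delta < 1)
    (Bh : R) (hBh : 0 < Bh)
    (h : 'cV[R]_n -> 'cV[R]_d) (hF2 : F2 nu Phi Bh h)
    (alpha : Theta -> 'cV[R]_d1) (halpha : represents nu Phi Bh alpha h)
    (K : nat) (hK : (0 < K)%N)
    (eta : R) (heta : eta = delta / (2 * K%:R))
    (* the integrand of the Rademacher expectation is measurable *)
    (hmeas : forall s : 'I_K -> R, (forall i, s i = 1 \/ s i = -1) ->
       measurable_fun [set: K.-tuple Theta]
         (fun t => signed_sum_norm Phi X (BPhi eta) alpha s (tnth t)))
    (dO : measure_display) (Omega : measurableType dO)
    (P : probability Omega R)
    (theta : 'I_K -> Omega -> Theta) (eps : 'I_K -> Omega -> R)
    (htheta : forall i, has_law P (theta i) nu)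
    (heps : forall i, rademacher P (eps i))
    (hindep : mutually_independent P theta eps) :
  prob_ge P
    [set w | exists a : 'I_K -> 'cV[R]_d1,
       (forall i, norm2 (a i) <= Bh) /\
       (supnorm X
          (fun x => K%:R^-1 *: \sum_(i < K) (Phi x (theta i w) *m a i) - h x)%R
        <= (2 / K%:R)%R%:E *
             \int[P]_w' signed_sum_norm Phi X (BPhi eta) alpha
                          (fun i => eps i w') (fun i => theta i w')
           + (Num.sqrt 2 * BPhi eta * Bh * Num.sqrt (ln (2 / delta) / K%:R))%R%:E
           + Bh%:E * sqrte ((delta / (2 * K%:R))%R%:E *
               ereal_sup [set 'E_nu[(fun t => opnorm (Phi x t) ^+ 2)%R] | x in X])
        )%E]
    (1 - delta).
Proof.
have /andP[delta0 delta1] := hdelta.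
have [X0|/set0P X0] := eqVneq X set0.
  (* the left-hand side is then [-oo] *)
  exists setT; split => //; last first.
    by rewrite probability_setT lee_fin lerBlDr lerDl ltW.
  move=> w _; exists (fun=> 0); split=> [i|]; first by rewrite norm2_0 ltW.
  by rewrite /supnorm X0 image_set0 ereal_sup0 leNye.
have [x0 Xx0] := X0.
have [malpha _ _] := halpha.
have K_gt0 : 0 < K%:R :> R by rewrite ltr0n.
have K_ge1 : 1 <= K%:R :> R by rewrite ler1n.
have eta0 : 0 < eta by rewrite heta divr_gt0// mulr_gt0.
have eta1 : eta < 1.
  by rewrite heta ltr_pdivrMr ?mulr_gt0// mul1r; lra.
have Keta : K%:R * eta = delta / 2.
  by rewrite heta; field; rewrite gt_eqF.
set b := BPhi eta.
have [M [mM MX nuM]] : prob_le nu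
    [set t | (b%:E < ereal_sup [set (opnorm (Phi x t))%:E | x in X])%E] eta.
  by apply: hBPhi; rewrite eta0 eta1.
have le_b t x : ~ M t -> X x -> opnorm (Phi x t) <= b.
  move=> Mt Xx; rewrite leNgt; apply/negP => bPhi; apply: Mt; apply: MX => /=.
  apply: (@lt_le_trans _ _ (opnorm (Phi x t))%:E); first by rewrite lte_fin.
  by apply: ereal_sup_ubound; exists x.
have b0 : 0 <= b.
  have [t Mt] : exists t, ~ M t.
    apply: contrapT => /forallNP nM.
    have MT : M = setT by apply/seteqP; split => // t _; exact: contrapT (nM t).
    by move: nuM; rewrite MT probability_setT lee_fin leNgt eta1.
  exact: le_trans (opnorm_ge0 _) (le_b t x0 Mt Xx0).
pose D := [set t | norm2 (alpha t) <= Bh].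
have mnalpha := measurable_norm2 malpha.
have mD : measurable D.
  by rewrite -[D]setTI; exact: measurable_fun_le.
have nuD : nu (~` D) = 0%E by exact: represents_bound_ae halpha.
have [t0 Dt0] : D !=set0.
  apply/set0P/eqP => D0; move: nuD; rewrite D0 setC0 probability_setT => /eqP.
  by rewrite eqe oner_eq0.
(* Redirecting to [t0] the null set where [alpha] exceeds its bound makes the
   summands bounded everywhere, and the signed sums remain compositions of
   measurable ones. *)
pose r t := if norm2 (alpha t) <= Bh then t else t0.
have rD t : D t -> r t = t by rewrite /D /r /= => ->.
have Dr t : norm2 (alpha (r t)) <= Bh by rewrite /r; case: ifP.
have mr : measurable_fun setT r.
  by apply: measurable_fun_ifT => //; exact: measurable_fun_ler.
pose g x t := truncate Phi b x (r t) *m alpha (r t).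
pose c := b * Bh.
have gc x t : norm2 (g x t) <= c by exact: norm2_truncate_le.
have mg x i : measurable_fun setT (fun t => g x t i 0).
  apply: measurable_mulmx => [j k|j].
    exact: (measurableT_comp (measurable_truncate hPhi b x j k) mr).
  exact: (measurableT_comp (malpha j) mr).
pose sgn (b : bool) : R := if b then 1 else -1.
pose rt (t : K.-tuple Theta) := [tuple r (tnth t i) | i < K].
have mrt : measurable_fun setT rt.
  apply/measurable_fun_tnthP => i.
  rewrite [X in measurable_fun _ X](_ : _ = r \o (fun t : K.-tuple Theta => tnth t i)).
    exact: measurableT_comp mr (measurable_tnth i).
  by apply/funext => t /=; rewrite tnth_mktuple.
pose S (s : {ffun 'I_K -> bool}) t := signed_sum_norm Phi X b alpha (sgn \o s) (tnth t).
have mS s : measurable_fun setT (S s).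
  by apply: hmeas => i /=; rewrite /sgn; case: (s i); [left|right].
have SrE s t : S s (rt t) = supnorm X (fun x => \sum_i sgn (s i) *: g x (tnth t i)).
  rewrite /S /signed_sum_norm; congr (supnorm X _); apply/funext => x.
  by apply: eq_bigr => i _; rewrite tnth_mktuple.
have Sr_bound s t : (0 <= S s (rt t) <= (K%:R * c)%:E)%E.
  rewrite SrE supnorm_ge0//=; apply: supnorm_le => x _.
  apply: norm2_signed_sum_le => // i; rewrite /sgn.
  by case: (s i); rewrite ?normrN normr1.
pose W s t := fine (S s (rt t)).
have WE s t : S s (rt t) = (W s t)%:E.
  have /andP[S0 Sc] := Sr_bound s t.
  by rewrite fineK// ge0_fin_numE// (le_lt_trans Sc)// ltry.
have mW s : measurable_fun setT (W s).
  exact: measurableT_comp (@fine_measurable R _ measurableT) (measurableT_comp (mS s) mrt).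
have W_bound s t : 0 <= W s t <= K%:R * c.
  by rewrite -!lee_fin -WE; exact: Sr_bound.
set I := (\int[P]_w' signed_sum_norm _ _ _ _ _ _)%E.
have I0 : (0 <= I)%E by apply: integral_ge0 => w _; exact: supnorm_ge0.
have [s Js] : exists s, ((\int[iid nu K]_t W s t)%:E <= I)%E.
  apply: (exists_signs_le htheta heps hindep mD nuD mW W_bound) => [w|w s Dw ew].
    exact: supnorm_ge0.
  rewrite -WE /S; congr (signed_sum_norm _ _ _ _ _ _); apply/funext => i /=.
    exact: ew.
  by rewrite !tnth_mktuple rD.
set J := \int[iid nu K]_t W s t in Js.
pose L := ln (2 / delta).
have L0 : 0 <= L.
  by rewrite ln_ge0// ler_pdivlMr// mul1r; lra.
have [A [mA nuA HA]] := uniform_deviation nu X0 mg gc hK (mW s)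
  (fun t => etrans (esym (SrE s t)) (WE s t)) L0.
have expL : expR (- L) = delta / 2.
  by rewrite expRN lnK ?posrE ?divr_gt0// invf_div.
set V := ereal_sup _.
have V_ub x : X x -> (\int[nu]_t (opnorm (Phi x t) ^+ 2)%:E <= V)%E.
  move=> Xx; apply: ereal_sup_ubound; exists x => //.
  by rewrite unlock.
have V0 : (0 <= V)%E.
  by apply: le_trans (V_ub x0 Xx0); apply: integral_ge0 => t _; rewrite lee_fin sqr_ge0.
have bias v x : V = v%:E -> X x ->
    norm2 (\col_j \int[nu]_t g x t j 0 - h x) <= Bh * Num.sqrt (eta * v).
  move=> Vv Xx; have v0 : 0 <= v by rewrite -lee_fin -Vv.
  apply: (truncation_bias_le hPhi halpha) => //; first exact: ltW.
    by rewrite -Vv; exact: V_ub.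
  apply: le_trans nuM; apply: le_measure; rewrite ?inE//.
    exact: measurable_superlevel (measurable_opnorm (hPhi x)).
  move=> t /= bt; apply: contrapT => Mt.
  by have := le_b t x Mt Xx; rewrite leNgt bt.
(* the exceptional event: a large deviation, or one exceptional draw *)
pose N := M `|` ~` D.
have mN : measurable N by apply: measurableU => //; exact: measurableC.
have nuN : (nu N <= eta%:E)%E.
  rewrite (le_trans (measureU2 _ _ _))//; first exact: measurableC.
  by rewrite [X in (_ + X)%E](_ : _ = 0%E)// adde0.
pose bad := sample theta @^-1` A `|` \big[setU/set0]_(i < K) (theta i @^-1` N).
have mth i B : measurable B -> measurable (theta i @^-1` B).
  by move=> mB; rewrite -[X in measurable X]setTI; exact: (htheta i).1.
have mbad1 : measurable (sample theta @^-1` A).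
  by rewrite -[X in measurable X]setTI; exact: (measurable_sample htheta).
have mbad2 : measurable (\big[setU/set0]_(i < K) (theta i @^-1` N)).
  by apply: bigsetU_measurable => i _; exact: mth.
have mbad : measurable bad by exact: measurableU.
have Pbad : (P bad <= delta%:E)%E.
  rewrite (le_trans (measureU2 _ _ _))//.
  have -> : delta%:E = ((delta / 2)%:E + (delta / 2)%:E)%E by rewrite -EFinD -splitr.
  apply: leeD.
    rewrite -expL; apply: le_trans nuA; rewrite le_eqVlt; apply/orP; left.
    by apply/eqP; exact: (prob_sample htheta hindep).
  apply: (le_trans (measure_bigsetU_le P _ (fun i => mth i _ mN))).
  apply: (@le_trans _ _ (\sum_(i < K) eta%:E)%E).
    apply: lee_sum => i _; apply: le_trans nuN.
    by rewrite le_eqVlt; apply/orP; left; apply/eqP; exact: (htheta i).2.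
  by rewrite sumEFin lee_fin sumr_const card_ord -[eta *+ K]mulr_natl Keta.
exists (~` bad); split; first exact: measurableC.
  move=> w /= nbad.
  have nA : ~ A (sample theta w) by move=> ?; apply: nbad; left.
  have nN i : ~ N (theta i w).
    by move=> ?; apply: nbad; right; rewrite -bigcup_seq; exists i => //=; rewrite mem_index_enum.
  have Dth i : D (theta i w) by apply: contrapT => ?; apply: (nN i); right.
  have nM i : ~ M (theta i w) by move=> ?; apply: (nN i); left.
  exists (fun i => alpha (theta i w)); split; first by move=> i; exact: Dth.
  have [Voo|Vfin] := eqVneq V +oo%E.
    rewrite Voo gt0_muley ?lte_fin -?heta// gt0_muley ?lte_fin//.
    rewrite addey ?leey// gt_eqF// (@lt_le_trans _ _ 0%E)// adde_ge0//.
      by rewrite mule_ge0// lee_fin divr_ge0.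
    by rewrite lee_fin !mulr_ge0 ?sqrtr_ge0// ltW.
  have [v Vv] : exists v, V = v%:E.
    by exists (fine V); rewrite fineK// ge0_fin_numE// ltey.
  apply: (le_trans _ (leeD (leeD (lee_wpmul2l _ Js) (lexx _)) (lexx _))).
    rewrite Vv -!EFinM /= -!EFinD -heta.
    apply: supnorm_le => x Xx.
    set m := \col_j \int[nu]_t g x t j 0.
    have -> : K%:R^-1 *: \sum_i Phi x (theta i w) *m alpha (theta i w) - h x =
        (K%:R^-1 *: \sum_i g x (tnth (sample theta w) i) - m) + (m - h x).
      rewrite addrA subrK; congr (_ *: _ - _); apply: eq_bigr => i _.
      by rewrite tnth_mktuple /g rD// /truncate le_b.
    apply: (le_trans (ler_norm2D _ _)); apply: lerD; last exact: bias.
    by have := HA _ nA x Xx; rewrite /c !mulrA.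
  by rewrite lee_fin divr_ge0.
rewrite probability_setC// EFinB; apply: leeB => //.
Qed.
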